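(* Let $a,b,c:\mathbb R\to\mathbb R$ be smooth functions satisfying hypothesis (H), let $m$ be a smooth compactly supported symbol on $\mathbb R^2$, and let $f,g\in\mathcal S(\mathbb R)$. Assume that $\phi(\xi,\eta)=-a(\xi+\eta)+b(\xi)+c(\eta)$ does not vanish on $\operatorname{Supp} m$ (i.e. there are no time resonances). Then the solution $u$ of the system described in the context satisfies, as $t\to\infty$, $$u(t)=e^{ita(D)}F+O\left(\frac1t\right),\qquad F=T_{m/\phi}(f,g).$$
   Context: Hypothesis (H): the second derivatives $a'',b'',c''$ are bounded away from zero. For a symbol $\sigma$ on $\mathbb R^2$, the bilinear Fourier multiplier is $T_\sigma(f,g)(x)=\int_{\mathbb R^2}e^{ix(\xi+\eta)}\widehat f(\xi)\widehat g(\eta)\sigma(\xi,\eta)\,d\xi\,d\eta$ (normalizing constants dropped). $e^{ita(D)}$ denotes the Fourier multiplier with symbol $e^{ita(\xi)}$. The solution $u$ is defined by the system $i\partial_tu+a(D)u=T_m(v,w)$, $i\partial_tv+b(D)v=0$, $i\partial_tw+c(D)w=0$ on $\mathbb R_t\times\mathbb R_x$, with $u(0)=0$, $v(0)=f$, $w(0)=g$; equivalently $u(t)=-ie^{ita(D)}\int_0^tT_{me^{is\phi}}(f,g)\,ds$. *)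

(* Defs.v *)
From Stdlib Require Import Reals List.
Import ListNotations.
From Coquelicot Require Import Coquelicot.
Open Scope R_scope.

Definition cis (t : R) : C := (cos t, sin t).

Definition integral_R (h : R -> C) : C :=
  @RInt_gen C_R_CompleteNormedModule h (Rbar_locally m_infty) (Rbar_locally p_infty).

Definition integral_0t (h : R -> C) (t : R) : C :=
  @RInt C_R_CompleteNormedModule h 0 t.

Definition smooth (a : R -> R) : Prop := forall (n : nat) (x : R), ex_derive_n a n x.

Definition schwartz_R (f : R -> R) : Prop :=
  smooth f /\
  forall (n k : nat), exists M : R, forall x : R, Rabs (x ^ k * Derive_n f n x) <= M.
Definition schwartz (f : R -> C) : Prop :=
  schwartz_R (fun x => Re (f x)) /\ schwartz_R (fun x => Im (f x)).

Fixpoint ipartial (s : list bool) (m : R -> R -> R) : R -> R -> R :=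
  match s with
  | nil => m
  | cons true s' => fun x y => Derive (fun x' => ipartial s' m x' y) x
  | cons false s' => fun x y => Derive (fun y' => ipartial s' m x y') y
  end.

Definition smooth2_R (m : R -> R -> R) : Prop :=
  forall s : list bool,
    (forall x y, ex_derive (fun x' => ipartial s m x' y) x /\
                 ex_derive (fun y' => ipartial s m x y') y) /\
    (forall x y, continuous (fun p : R * R => ipartial s m (fst p) (snd p)) (x, y)).
Definition smooth2 (m : R -> R -> C) : Prop :=
  smooth2_R (fun x y => Re (m x y)) /\ smooth2_R (fun x y => Im (m x y)).

Definition compact_support2 (m : R -> R -> C) : Prop :=
  exists K : R, forall xi eta, K < Rabs xi \/ K < Rabs eta -> m xi eta = 0%C.

Definition in_supp (m : R -> R -> C) (xi eta : R) : Prop :=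
  forall eps : R, 0 < eps -> exists xi' eta',
    Rabs (xi' - xi) < eps /\ Rabs (eta' - eta) < eps /\ m xi' eta' <> 0%C.

Definition second_deriv_away_from_zero (a : R -> R) : Prop :=
  exists delta : R, 0 < delta /\ forall x, delta <= Rabs (Derive_n a 2 x).

Definition fourier (f : R -> C) (xi : R) : C :=
  integral_R (fun x => (cis (- (x * xi)) * f x)%C).
Definition inv_fourier (h : R -> C) (x : R) : C :=
  (RtoC (/ (2 * PI)) * integral_R (fun xi => (cis (x * xi) * h xi)%C))%C.

Definition propagator (a : R -> R) (t : R) (h : R -> C) : R -> C :=
  inv_fourier (fun xi => (cis (t * a xi) * fourier h xi)%C).

(* bilinear Fourier multiplier T_sigma (with the normalisation (2pi)^{-2},
   so that T_1(f,g) = f g) *)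
Definition bilinear (sigma : R -> R -> C) (f g : R -> C) (x : R) : C :=
  (RtoC (/ (2 * PI) ^ 2) *
   integral_R (fun xi => integral_R (fun eta =>
     (cis (x * (xi + eta)) * fourier f xi * fourier g eta * sigma xi eta)%C)))%C.

Definition phase (a b c : R -> R) (xi eta : R) : R :=
  - a (xi + eta) + b xi + c eta.

Definition solution (a b c : R -> R) (m : R -> R -> C) (f g : R -> C)
    (t : R) : R -> C :=
  fun x => (- Ci * propagator a t (fun y =>
     integral_0t (fun s =>
       bilinear (fun xi eta => (m xi eta * cis (s * phase a b c xi eta))%C) f g y) t) x)%C.

(* Main.v *)
Require Import Defs.
From Stdlib Require Import Reals Lra ClassicalEpsilon FunctionalExtensionality.
From Coquelicot Require Import Coquelicot.
Open Scope R_scope.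

(** Duhamel's integral gives [T_(m (e^(i t phi) - 1) / phi)] up to sign, so the error [u(t) - e^(i t a(D)) F] is
    [- e^(i t a(D)) T_(e^(i t phi) m / phi) (f, g)]. By Fourier inversion [e^(i t a(D))] multiplies the symbol by
    [e^(i t a(xi + eta))], which cancels the [a]-part of [phi] and leaves the oscillatory integral
    [int int e^(i (x xi + t b xi)) e^(i (x eta + t c eta)) M(xi, eta)] with [M] smooth and compactly supported.
    Van der Corput's second derivative test gives each exponential a primitive of size [O(t^(-1/2))], uniformly in
    [x], and integrating by parts once in each variable yields [O(1/t)]. *)

(** Cancelling the [a]-part matters because the remaining phase is a function of [xi] plus a
    function of [eta]: the two exponentials separate, and integrating by parts in each variable
    costs only the mixed second derivative of [M]. The term linear in [x] leaves the second
    derivative of each phase, hence the uniformity.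

    The obstacle is that the propagator is defined from the physical side: it takes the Fourier
    transform of a function which is itself an oscillatory integral, and [integral_R] is a total
    operator whose value means nothing until convergence is known. So an inversion theorem is
    needed, but only for transforms of [C^2] compactly supported functions. These decay like
    [1 / x^2], so their transforms converge and may be computed along symmetric intervals [(-B, B)],
    where Fubini produces the Dirichlet kernel. The normalisation of that kernel, the integral of
    [sin x / x], is obtained from a real parameter integral over a quarter circle, with a
    quantitative decay rate.

    Regularity [C^2] suffices throughout: for the decay above and for the mixed derivative of
    [M]. *)

Local Notation derivC := (@is_derive R_AbsRing C_R_NormedModule).
Local Notation contC := (@continuous _ C_R_NormedModule).
Local Notation is_intC := (@is_RInt C_R_NormedModule).

(** * Calculus of complex-valued functions of a real variable *)

Definition intC (h : R -> C) (a b : R) : C := @RInt C_R_CompleteNormedModule h a b.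

(** The library's norm on a product is Euclidean, so its estimates for vector-valued integrals
    become estimates on the modulus. *)
Lemma norm_C (z : C) : norm (V := C_R_NormedModule) z = Cmod z.
Proof.
  unfold norm; simpl; unfold prod_norm; simpl.
  unfold norm; simpl; unfold abs; simpl; unfold Cmod.
  f_equal. rewrite !Rmult_1_r, <- !Rabs_mult, !Rabs_pos_eq by nra. ring.
Qed.

Lemma continuous_C_pair {T : UniformSpace} (u v : T -> R) (x : T) :
  continuous u x -> continuous v x -> contC (fun t => (u t, v t) : C) x.
Proof.
  intros Hu Hv. apply filterlim_locally. intros eps.
  generalize (proj1 (filterlim_locally _ _) Hu eps) (proj1 (filterlim_locally _ _) Hv eps).
  intros H1 H2. generalize (filter_and _ _ H1 H2). apply filter_imp.
  intros y [A B]. split; assumption.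
Qed.

Lemma continuous_Re {T : UniformSpace} (f : T -> C) (x : T) :
  contC f x -> continuous (fun t => Re (f t)) x.
Proof.
  intros H. apply (continuous_comp f (fst : C_R_NormedModule -> R)).
  - exact H.
  - destruct (f x) as [p q]. apply (continuous_fst (U := R_UniformSpace) (V := R_UniformSpace)).
Qed.

Lemma continuous_Im {T : UniformSpace} (f : T -> C) (x : T) :
  contC f x -> continuous (fun t => Im (f t)) x.
Proof.
  intros H. apply (continuous_comp f (snd : C_R_NormedModule -> R)).
  - exact H.
  - destruct (f x) as [p q]. apply (continuous_snd (U := R_UniformSpace) (V := R_UniformSpace)).
Qed.

Lemma continuous_RtoC {T : UniformSpace} (u : T -> R) (x : T) :
  continuous u x -> contC (fun t => RtoC (u t)) x.
Proof. intros H. apply continuous_C_pair; [exact H | apply continuous_const]. Qed.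

Lemma continuous_Cmult {T : UniformSpace} (f g : T -> C) (x : T) :
  contC f x -> contC g x -> contC (fun t => (f t * g t)%C) x.
Proof.
  intros Hf Hg.
  apply continuous_C_pair.
  - apply (continuous_minus (V := R_NormedModule)); apply (continuous_mult (K := R_AbsRing));
    [apply (continuous_Re f) | apply (continuous_Re g) | apply (continuous_Im f) | apply (continuous_Im g)];
    assumption.
  - apply (continuous_plus (V := R_NormedModule)); apply (continuous_mult (K := R_AbsRing));
    [apply (continuous_Re f) | apply (continuous_Im g) | apply (continuous_Im f) | apply (continuous_Re g)];
    assumption.
Qed.

Lemma continuous_Cplus {T : UniformSpace} (f g : T -> C) (x : T) :
  contC f x -> contC g x -> contC (fun t => (f t + g t)%C) x.
Proof. apply (continuous_plus (V := C_R_NormedModule)). Qed.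

Lemma continuous_Cminus {T : UniformSpace} (f g : T -> C) (x : T) :
  contC f x -> contC g x -> contC (fun t => (f t - g t)%C) x.
Proof. apply (continuous_minus (V := C_R_NormedModule)). Qed.

Lemma continuous_Cinv {T : UniformSpace} (f : T -> C) (x : T) :
  f x <> 0%C -> contC f x -> contC (fun t => (/ f t)%C) x.
Proof.
  intros Hn Hf.
  (* Spelled as the unfolded denominator of [Cinv], so that the two components below match by
     conversion. *)
  assert (Hd : Re (f x) * (Re (f x) * 1) + Im (f x) * (Im (f x) * 1) <> 0).
  { intros E. apply Hn. destruct (f x) as [p q]. simpl in E.
    assert (p = 0) by nra. assert (q = 0) by nra. subst. reflexivity. }
  assert (Hr := continuous_Re f x Hf). assert (Hi := continuous_Im f x Hf).
  assert (Hc : continuous (fun t => / (Re (f t) * (Re (f t) * 1) + Im (f t) * (Im (f t) * 1))) x).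
  { apply (continuous_comp (fun t => Re (f t) * (Re (f t) * 1) + Im (f t) * (Im (f t) * 1)) Rinv).
    - apply (continuous_plus (V := R_NormedModule)); apply (continuous_mult (K := R_AbsRing));
      try assumption; apply (continuous_mult (K := R_AbsRing)); try assumption; apply continuous_const.
    - apply continuous_Rinv. exact Hd. }
  apply continuous_C_pair.
  - apply (continuous_mult (K := R_AbsRing)); assumption.
  - apply (continuous_mult (K := R_AbsRing)); [|assumption].
    apply (continuous_opp (V := R_NormedModule)). assumption.
Qed.

Lemma continuous_cis {T : UniformSpace} (u : T -> R) (x : T) :
  continuous u x -> contC (fun t => cis (u t)) x.
Proof.
  intros H. apply continuous_C_pair.
  - apply (continuous_comp u cos); [exact H | apply continuous_cos].
  - apply (continuous_comp u sin); [exact H | apply continuous_sin].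
Qed.

Lemma continuous_Cmod {T : UniformSpace} (f : T -> C) (x : T) :
  contC f x -> continuous (fun t => Cmod (f t)) x.
Proof.
  intros H. apply (continuous_ext (fun t => norm (V := C_R_NormedModule) (f t))).
  - intros t. apply norm_C.
  - apply (continuous_comp f (norm (V := C_R_NormedModule))); [exact H |].
    exact (filterlim_norm (K := R_AbsRing) (V := C_R_NormedModule) (f x)).
Qed.

Lemma is_derive_C_pair (u v : R -> R) (x du dv : R) :
  is_derive u x du -> is_derive v x dv ->
  derivC (fun t => (u t, v t) : C) x (du, dv).
Proof.
  intros Hu Hv.
  (* As a combination of the fixed vectors [(1, 0)] and [(0, 1)], the pair is differentiated by
     linearity alone. *)
  apply (is_derive_ext (V := C_R_NormedModule)
    (fun t => plus (scal (u t) ((1, 0) : C_R_NormedModule)) (scal (v t) ((0, 1) : C_R_NormedModule)))).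
  - intros t. unfold plus, scal; simpl. unfold prod_plus, prod_scal, plus, scal; simpl.
    unfold mult; simpl. f_equal; ring.
  - replace ((du, dv) : C) with
      (plus (scal du ((1, 0) : C_R_NormedModule)) (scal dv ((0, 1) : C_R_NormedModule))).
    + apply (is_derive_plus (V := C_R_NormedModule));
      apply (is_derive_scal_l (V := C_R_NormedModule)); assumption.
    + unfold plus, scal; simpl. unfold prod_plus, prod_scal, plus, scal; simpl.
      unfold mult; simpl. f_equal; ring.
Qed.

Lemma is_derive_Re (f : R -> C) (x : R) (l : C) :
  derivC f x l -> is_derive (fun t => Re (f t)) x (Re l).
Proof.
  intros H. unfold is_derive.
  apply (filterdiff_ext_lin (K := R_AbsRing) (U := AbsRing_NormedModule R_AbsRing) (V := R_NormedModule)
    _ (fun y : R => Re (scal y (l : C_R_NormedModule)))).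
  - apply (filterdiff_comp' (K := R_AbsRing) (U := AbsRing_NormedModule R_AbsRing) (V := C_R_NormedModule) (W := R_NormedModule)
      f (fst : C -> R) x (fun y : R => scal y (l : C_R_NormedModule)) (fst : C -> R)).
    + exact H.
    + apply filterdiff_linear. apply (is_linear_fst (U := R_NormedModule) (V := R_NormedModule)).
  - intros y. reflexivity.
Qed.

Lemma is_derive_Im (f : R -> C) (x : R) (l : C) :
  derivC f x l -> is_derive (fun t => Im (f t)) x (Im l).
Proof.
  intros H. unfold is_derive.
  apply (filterdiff_ext_lin (K := R_AbsRing) (U := AbsRing_NormedModule R_AbsRing) (V := R_NormedModule)
    _ (fun y : R => Im (scal y (l : C_R_NormedModule)))).
  - apply (filterdiff_comp' (K := R_AbsRing) (U := AbsRing_NormedModule R_AbsRing) (V := C_R_NormedModule) (W := R_NormedModule)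
      f (snd : C -> R) x (fun y : R => scal y (l : C_R_NormedModule)) (snd : C -> R)).
    + exact H.
    + apply filterdiff_linear. apply (is_linear_snd (U := R_NormedModule) (V := R_NormedModule)).
  - intros y. reflexivity.
Qed.

Lemma is_derive_RtoC (u : R -> R) (x l : R) :
  is_derive u x l -> derivC (fun t => RtoC (u t)) x (RtoC l).
Proof. intros H. apply is_derive_C_pair; [exact H | apply (is_derive_const (V := R_NormedModule))]. Qed.

Lemma is_derive_Cmult (f g : R -> C) (x : R) (df dg : C) :
  derivC f x df -> derivC g x dg ->
  derivC (fun t => (f t * g t)%C) x (df * g x + f x * dg)%C.
Proof.
  intros Hf Hg.
  assert (A := is_derive_Re _ _ _ Hf). assert (B := is_derive_Im _ _ _ Hf).
  assert (A' := is_derive_Re _ _ _ Hg). assert (B' := is_derive_Im _ _ _ Hg).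
  replace (df * g x + f x * dg)%C with
   ((Re df * Re (g x) + Re (f x) * Re dg) - (Im df * Im (g x) + Im (f x) * Im dg),
    (Re df * Im (g x) + Re (f x) * Im dg) + (Im df * Re (g x) + Im (f x) * Re dg)).
  - apply is_derive_C_pair.
    + apply (is_derive_minus (V := R_NormedModule));
      apply (is_derive_mult (K := R_AbsRing)); try assumption; intros; apply Rmult_comm.
    + apply (is_derive_plus (V := R_NormedModule));
      apply (is_derive_mult (K := R_AbsRing)); try assumption; intros; apply Rmult_comm.
  - apply injective_projections; unfold Re, Im; simpl; ring.
Qed.

Lemma is_derive_Cscal (k : C) (f : R -> C) (x : R) (df : C) :
  derivC f x df -> derivC (fun t => (k * f t)%C) x (k * df)%C.
Proof.
  intros Hf. replace (k * df)%C with (0 * f x + k * df)%C by ring.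
  apply (is_derive_Cmult (fun _ => k)); [|exact Hf].
  apply (is_derive_const (V := C_R_NormedModule)).
Qed.

Lemma is_derive_cis (u : R -> R) (x du : R) :
  is_derive u x du -> derivC (fun t => cis (u t)) x (Ci * RtoC du * cis (u x))%C.
Proof.
  intros H.
  replace (Ci * RtoC du * cis (u x))%C with ((du * - sin (u x), du * cos (u x)) : C)
    by (apply injective_projections; simpl; ring).
  apply is_derive_C_pair.
  - apply (is_derive_comp (V := R_NormedModule) cos u); [apply is_derive_cos | exact H].
  - apply (is_derive_comp (V := R_NormedModule) sin u); [apply is_derive_sin | exact H].
Qed.

Lemma is_derive_C_unique (f : R -> C) (x : R) (l l' : C) :
  derivC f x l -> derivC f x l' -> l = l'.
Proof.
  intros H H'. apply injective_projections.
  - change (Re l = Re l'). rewrite <- (is_derive_unique _ _ _ (is_derive_Re _ _ _ H)).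
    apply (is_derive_unique _ _ _ (is_derive_Re _ _ _ H')).
  - change (Im l = Im l'). rewrite <- (is_derive_unique _ _ _ (is_derive_Im _ _ _ H)).
    apply (is_derive_unique _ _ _ (is_derive_Im _ _ _ H')).
Qed.

Lemma is_derive_continuousC (f : R -> C) (x : R) (l : C) : derivC f x l -> contC f x.
Proof. intros H. apply (ex_derive_continuous (V := C_R_NormedModule)). exists l. exact H. Qed.

(** * The unit-modulus character [cis] *)

Lemma Cmod_cis (t : R) : Cmod (cis t) = 1.
Proof.
  unfold Cmod, cis; simpl. rewrite !Rmult_1_r.
  rewrite Rplus_comm. change (sqrt (Rsqr (sin t) + Rsqr (cos t)) = 1).
  rewrite sin2_cos2. apply sqrt_1.
Qed.

Lemma cis_plus (s t : R) : cis (s + t) = (cis s * cis t)%C.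
Proof. unfold cis. rewrite cos_plus, sin_plus. apply injective_projections; simpl; ring. Qed.

Lemma cis_0 : cis 0 = 1%C.
Proof. unfold cis. rewrite cos_0, sin_0. reflexivity. Qed.

(** * Integrals of continuous complex-valued functions over an interval *)

Lemma ex_intC (f : R -> C) (a b : R) :
  (forall x, contC f x) -> is_intC f a b (intC f a b).
Proof.
  intros H. apply (RInt_correct (V := C_R_CompleteNormedModule)).
  apply (ex_RInt_continuous (V := C_R_CompleteNormedModule)). intros; apply H.
Qed.

Lemma intC_unique (f : R -> C) (a b : R) (l : C) : is_intC f a b l -> intC f a b = l.
Proof. apply (is_RInt_unique (V := C_R_CompleteNormedModule)). Qed.

Lemma is_intC_components (f : R -> C) (a b : R) (l : C) :
  is_intC f a b l <-> is_RInt (fun x => Re (f x)) a b (Re l) /\ is_RInt (fun x => Im (f x)) a b (Im l).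
Proof.
  split.
  - intros H. split.
    + apply (is_RInt_fct_extend_fst (U := R_NormedModule) (V := R_NormedModule)). exact H.
    + apply (is_RInt_fct_extend_snd (U := R_NormedModule) (V := R_NormedModule)). exact H.
  - intros [H1 H2]. destruct l as [p q].
    apply (is_RInt_fct_extend_pair (U := R_NormedModule) (V := R_NormedModule)); assumption.
Qed.

Lemma is_intC_scal (k : C) (f : R -> C) (a b : R) (l : C) :
  is_intC f a b l -> is_intC (fun x => (k * f x)%C) a b (k * l)%C.
Proof.
  intros H. apply is_intC_components in H. destruct H as [H1 H2].
  apply is_intC_components. split.
  - apply (is_RInt_minus (V := R_NormedModule)); apply (is_RInt_scal (V := R_NormedModule)); assumption.
  - apply (is_RInt_plus (V := R_NormedModule)); apply (is_RInt_scal (V := R_NormedModule)); assumption.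
Qed.

Lemma intC_scal (k : C) (f : R -> C) (a b : R) :
  (forall x, contC f x) -> intC (fun x => (k * f x)%C) a b = (k * intC f a b)%C.
Proof. intros H. apply intC_unique, is_intC_scal, ex_intC, H. Qed.

Lemma intC_ext (f g : R -> C) (a b : R) :
  (forall x, Rmin a b < x < Rmax a b -> f x = g x) -> intC f a b = intC g a b.
Proof. apply (RInt_ext (V := C_R_CompleteNormedModule)). Qed.

Lemma intC_plus (f g : R -> C) (a b : R) :
  (forall x, contC f x) -> (forall x, contC g x) ->
  intC (fun x => (f x + g x)%C) a b = (intC f a b + intC g a b)%C.
Proof.
  intros Hf Hg. apply intC_unique.
  apply (is_RInt_plus (V := C_R_NormedModule)); apply ex_intC; assumption.
Qed.

Lemma intC_minus (f g : R -> C) (a b : R) :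
  (forall x, contC f x) -> (forall x, contC g x) ->
  intC (fun x => (f x - g x)%C) a b = (intC f a b - intC g a b)%C.
Proof.
  intros Hf Hg. apply intC_unique.
  apply (is_RInt_minus (V := C_R_NormedModule)); apply ex_intC; assumption.
Qed.

Lemma intC_zero (a b : R) : intC (fun _ => RtoC 0) a b = 0%C.
Proof.
  apply intC_unique.
  generalize (is_RInt_const (V := C_R_NormedModule) a b zero).
  rewrite (scal_zero_r (V := C_R_NormedModule)). intros H; exact H.
Qed.

Lemma intC_Chasles (f : R -> C) (a b c : R) :
  (forall x, contC f x) -> (intC f a b + intC f b c)%C = intC f a c.
Proof.
  intros H. symmetry. apply intC_unique.
  apply (is_RInt_Chasles (V := C_R_NormedModule)) with b; apply ex_intC; assumption.
Qed.

Lemma intC_derive (f df : R -> C) (a b : R) :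
  (forall x, derivC f x (df x)) -> (forall x, contC df x) -> intC df a b = (f b - f a)%C.
Proof.
  intros H1 H2. apply intC_unique.
  apply (is_RInt_derive (V := C_R_CompleteNormedModule)); intros; auto.
Qed.

Lemma Cmod_intC_le (f : R -> C) (g : R -> R) (a b lg : R) :
  a <= b -> (forall x, contC f x) ->
  (forall x, a <= x <= b -> Cmod (f x) <= g x) -> is_RInt g a b lg ->
  Cmod (intC f a b) <= lg.
Proof.
  intros Hab Hf Hle Hg. rewrite <- norm_C.
  apply (norm_RInt_le (V := C_R_NormedModule) f g a b); try assumption.
  - intros x Hx. rewrite norm_C. apply Hle, Hx.
  - apply ex_intC, Hf.
Qed.

Lemma Cmod_intC_le_const (f : R -> C) (M a b : R) :
  a <= b -> (forall x, contC f x) ->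
  (forall x, a <= x <= b -> Cmod (f x) <= M) -> Cmod (intC f a b) <= (b - a) * M.
Proof.
  intros Hab Hf Hle. apply (Cmod_intC_le f (fun _ => M)); try assumption.
  apply (is_RInt_const (V := R_NormedModule)).
Qed.

Lemma intC_by_parts (f g df dg : R -> C) (a b : R) :
  (forall x, derivC f x (df x)) -> (forall x, derivC g x (dg x)) ->
  (forall x, contC df x) -> (forall x, contC dg x) ->
  intC (fun x => (df x * g x)%C) a b
  = (f b * g b - f a * g a - intC (fun x => (f x * dg x)%C) a b)%C.
Proof.
  intros Hf Hg Cdf Cdg.
  assert (Cf : forall x, contC f x) by (intros x; eapply is_derive_continuousC, Hf).
  assert (Cg : forall x, contC g x) by (intros x; eapply is_derive_continuousC, Hg).
  assert (E : intC (fun x => (df x * g x + f x * dg x)%C) a b = (f b * g b - f a * g a)%C).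
  { apply (intC_derive (fun x => (f x * g x)%C)).
    - intros x. apply is_derive_Cmult; auto.
    - intros x. apply continuous_Cplus; apply continuous_Cmult; auto. }
  rewrite intC_plus in E by (intros x; apply continuous_Cmult; auto).
  rewrite <- E. ring.
Qed.

Lemma is_derive_intC (f : R -> C) (a x : R) :
  (forall x, contC f x) -> derivC (fun y => intC f a y) x (f x).
Proof.
  intros H. apply (is_derive_RInt (V := C_R_NormedModule)) with a.
  - apply filter_forall. intros y. apply ex_intC, H.
  - apply H.
Qed.

(** * Integrals depending on a parameter *)

Definition contC2 {S T : UniformSpace} (h : S -> T -> C) : Prop :=
  forall p : S * T, contC (fun q : S * T => h (fst q) (snd q)) p.

Lemma contC2_comp {X S T : UniformSpace} (h : S -> T -> C) (u : X -> S) (v : X -> T) (x : X) :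
  contC2 h -> continuous u x -> continuous v x -> contC (fun z => h (u z) (v z)) x.
Proof. intros Hh Hu Hv. apply (continuous_comp_2 u v h); try assumption. apply Hh. Qed.

(** Joint continuity is uniform over the compact interval of integration, so [h t] tends to [h t0]
    uniformly there, and a uniform limit passes through the integral. *)
Lemma continuous_intC_param {T : UniformSpace} (h : T -> R -> C) (a b : R) (t0 : T) :
  contC2 h -> contC (fun t => intC (h t) a b) t0.
Proof.
  intros Hh.
  (* [filterlim_RInt] asks for uniform convergence on the whole line. Projecting the variable onto
     the interval changes no integral and confines the question to a compact set. *)
  set (clamp := fun y => Rmax (Rmin a b) (Rmin y (Rmax a b))).
  assert (Hlohi : Rmin a b <= Rmax a b) by apply Rmin_Rmax.
  assert (Hc1 : forall y, Rmin a b <= clamp y <= Rmax a b).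
  { intros y. split; [apply Rmax_l|]. apply Rmax_lub; [exact Hlohi | apply Rmin_r]. }
  assert (Hc2 : forall y, Rmin a b < y < Rmax a b -> clamp y = y).
  { intros y Hy. unfold clamp. rewrite (Rmin_left y) by lra. apply Rmax_right; lra. }
  assert (Hcont : forall t y, contC (h t) y).
  { intros t y. apply (contC2_comp h (fun _ => t) (fun z => z)); [exact Hh | apply continuous_const | apply continuous_id]. }
  assert (Hint : forall t, is_intC (fun y => h t (clamp y)) a b (intC (h t) a b)).
  { intros t. apply (is_RInt_ext (V := C_R_NormedModule) (h t)).
    - intros y Hy. rewrite Hc2 by exact Hy. reflexivity.
    - apply ex_intC, Hcont. }
  destruct (filterlim_RInt (V := C_R_CompleteNormedModule) (fun t y => h t (clamp y)) a b (locally t0)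
     (locally_filter t0) (fun y => h t0 (clamp y)) (fun t => intC (h t) a b) Hint) as [If [H1 H2]].
  2:{ unfold continuous.
      replace (intC (h t0) a b) with If; [exact H1|].
      rewrite <- (intC_unique _ _ _ _ H2). apply intC_unique, Hint. }
  apply filterlim_locally. intros eps.
  assert (He : 0 < eps / 2) by (generalize (cond_pos eps); lra).
  (* Joint continuity at [(t0, y)] yields a radius depending on [y]. These radii form a gauge, and
     compactness extracts one [d] such that every point of the interval lies within the radius of
     some [y'] whose radius is at least [d]. *)
  assert (Hdelta : forall y : R, exists d : posreal, forall t y', ball t0 d t -> ball y d y' ->
      ball (h t0 y : C_R_NormedModule) (eps / 2) (h t y')).
  { intros y. destruct (proj1 (filterlim_locally _ _) (Hh (t0, y)) (mkposreal _ He)) as [d Hd].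
    exists d. intros t y' Ht Hy. apply (Hd (t, y')). split; assumption. }
  set (delta := fun y => proj1_sig (constructive_indefinite_description _ (Hdelta y))).
  assert (Hdel : forall y t y', ball t0 (delta y) t -> ball y (delta y) y' ->
      ball (h t0 y : C_R_NormedModule) (eps / 2) (h t y')).
  { intros y. unfold delta. destruct (constructive_indefinite_description _ (Hdelta y)) as [d Hd]. exact Hd. }
  destruct (compactness_value_1d (Rmin a b) (Rmax a b) delta) as [d Hd].
  exists d. intros t Ht y.
  destruct (NNPP _ (Hd (clamp y) (Hc1 y))) as [y' [Hy' [Hyy Hdd]]].
  change (ball (h t0 (clamp y) : C_R_NormedModule) eps (h t (clamp y))).
  replace (pos eps) with (eps / 2 + eps / 2) by field.
  apply ball_triangle with (h t0 y' : C_R_NormedModule).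
  - apply ball_sym. apply Hdel; [apply ball_center | exact Hyy].
  - apply Hdel; [|exact Hyy]. apply ball_le with d; assumption.
Qed.

Lemma Re_intC (f : R -> C) (a b : R) :
  (forall x, contC f x) -> is_RInt (fun x => Re (f x)) a b (Re (intC f a b)).
Proof. intros H. exact (proj1 (proj1 (is_intC_components _ _ _ _) (ex_intC f a b H))). Qed.

Lemma Im_intC (f : R -> C) (a b : R) :
  (forall x, contC f x) -> is_RInt (fun x => Im (f x)) a b (Im (intC f a b)).
Proof. intros H. exact (proj2 (proj1 (is_intC_components _ _ _ _) (ex_intC f a b H))). Qed.

Lemma is_derive_RInt_param_cont (h hx : R -> R -> R) (a b x l : R) :
  (forall x y, is_derive (fun x' => h x' y) x (hx x y)) ->
  (forall x y, continuous (h x) y) ->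
  (forall p : R * R, continuous (fun q => hx (fst q) (snd q)) p) ->
  is_RInt (hx x) a b l ->
  is_derive (fun x' => RInt (h x') a b) x l.
Proof.
  intros Hd Hc Hcx Hl. rewrite <- (is_RInt_unique _ _ _ _ Hl).
  rewrite (RInt_ext (hx x) (fun t => Derive (fun u => h u t) x)).
  2:{ intros y _. symmetry. apply is_derive_unique, Hd. }
  apply is_derive_RInt_param.
  - apply filter_forall. intros x' t _. eexists. apply Hd.
  - intros t _. apply continuity_2d_pt_filterlim.
    replace (Derive (fun z => h z t) x) with (hx x t) by (symmetry; apply is_derive_unique, Hd).
    apply (filterlim_ext (fun q => hx (fst q) (snd q))).
    + intros q. symmetry. apply is_derive_unique, Hd.
    + apply (Hcx (x, t)).
  - apply filter_forall. intros x'.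
    apply (ex_RInt_continuous (V := R_CompleteNormedModule) (h x')). intros z _. exact (Hc x' z).
Qed.

Lemma is_derive_intC_param (h hx : R -> R -> C) (a b x : R) :
  (forall x y, derivC (fun x' => h x' y) x (hx x y)) ->
  (forall x y, contC (h x) y) -> contC2 hx ->
  derivC (fun x' => intC (h x') a b) x (intC (hx x) a b).
Proof.
  intros Hd Hc Hcx.
  assert (Hcx1 : forall x y, contC (hx x) y).
  { intros x' y. apply (contC2_comp hx (fun _ => x') (fun z => z)); [exact Hcx | apply continuous_const | apply continuous_id]. }
  apply (is_derive_ext (V := C_R_NormedModule)
    (fun x' => (RInt (fun y => Re (h x' y)) a b, RInt (fun y => Im (h x' y)) a b) : C)).
  - intros x'. rewrite (is_RInt_unique _ _ _ _ (Re_intC (h x') a b (Hc x'))).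
    rewrite (is_RInt_unique _ _ _ _ (Im_intC (h x') a b (Hc x'))).
    symmetry. apply surjective_pairing.
  - rewrite (surjective_pairing (intC (hx x) a b)).
    apply is_derive_C_pair.
    + apply (is_derive_RInt_param_cont _ (fun u v => Re (hx u v))).
      * intros. apply (is_derive_Re (fun x' => h x' y)), Hd.
      * intros. apply continuous_Re, Hc.
      * intros p. apply continuous_Re, Hcx.
      * apply Re_intC, Hcx1.
    + apply (is_derive_RInt_param_cont _ (fun u v => Im (hx u v))).
      * intros. apply (is_derive_Im (fun x' => h x' y)), Hd.
      * intros. apply continuous_Im, Hc.
      * intros p. apply continuous_Im, Hcx.
      * apply Im_intC, Hcx1.
Qed.

Lemma contC2_l {S T : UniformSpace} (h : S -> T -> C) (s : S) (t : T) :
  contC2 h -> contC (fun s' => h s' t) s.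
Proof. intros H. apply (contC2_comp h (fun z => z) (fun _ => t)); [exact H | apply continuous_id | apply continuous_const]. Qed.

Lemma contC2_r {S T : UniformSpace} (h : S -> T -> C) (s : S) (t : T) :
  contC2 h -> contC (h s) t.
Proof. intros H. apply (contC2_comp h (fun _ => s) (fun z => z)); [exact H | apply continuous_const | apply continuous_id]. Qed.

Lemma contC2_swap {S T : UniformSpace} (h : S -> T -> C) : contC2 h -> contC2 (fun t s => h s t).
Proof.
  intros H [t s]. apply (contC2_comp h snd fst); [exact H | apply continuous_snd | apply continuous_fst].
Qed.

Lemma intC_point (f : R -> C) (a : R) : intC f a a = 0%C.
Proof. apply (RInt_point (V := C_R_CompleteNormedModule)). Qed.

(* Both sides vanish at [B = a] and have the same derivative in the upper bound [B]. *)
Lemma intC_Fubini (h : R -> R -> C) (a b c d : R) :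
  contC2 h ->
  intC (fun x => intC (h x) c d) a b = intC (fun y => intC (fun x => h x y) a b) c d.
Proof.
  intros Hh.
  assert (D1 : forall B, derivC (fun B => intC (fun y => intC (fun x => h x y) a B) c d) B (intC (h B) c d)).
  { intros B. apply (is_derive_intC_param (fun B y => intC (fun x => h x y) a B)).
    - intros B' y. apply (is_derive_intC (fun x => h x y)). intros x. apply contC2_l, Hh.
    - intros B' y. apply (continuous_intC_param (fun y x => h x y)). apply contC2_swap, Hh.
    - exact Hh. }
  rewrite (intC_derive (fun B => intC (fun y => intC (fun x => h x y) a B) c d)).
  - rewrite (intC_ext (fun y => intC (fun x => h x y) a a) (fun _ => RtoC 0)).
    + rewrite intC_zero. ring.
    + intros y _. apply intC_point.
  - exact D1.
  - intros x. apply continuous_intC_param, Hh.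
Qed.

Lemma intC_comp_lin (f : R -> C) (a b v : R) :
  (forall x, contC f x) -> intC (fun y => f (y + v)) a b = intC f (a + v) (b + v).
Proof.
  intros Hf. apply intC_unique.
  apply (is_RInt_ext (V := C_R_NormedModule) (fun y => scal 1 ((f : R -> C_R_NormedModule) (1 * y + v)))).
  - intros y _. rewrite (scal_one (V := C_R_NormedModule)). rewrite Rmult_1_l. reflexivity.
  - apply (is_RInt_comp_lin (V := C_R_NormedModule)). rewrite !Rmult_1_l. apply ex_intC, Hf.
Qed.

Lemma intC_support (f : R -> C) (K a b : R) :
  (forall x, contC f x) -> (forall x, K < Rabs x -> f x = 0%C) ->
  0 <= K -> a <= - K -> K <= b -> intC f a b = intC f (- K) K.
Proof.
  intros Hc Hs HK Ha Hb.
  rewrite <- (intC_Chasles f a (- K) b Hc), <- (intC_Chasles f (- K) K b Hc).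
  rewrite (intC_ext f (fun _ => RtoC 0) a (- K)), (intC_ext f (fun _ => RtoC 0) K b), !intC_zero.
  - ring.
  - intros x. rewrite Rmin_left by lra. rewrite Rmax_right by lra. intros Hx.
    apply Hs. rewrite Rabs_pos_eq; lra.
  - intros x. rewrite Rmin_left by lra. rewrite Rmax_right by lra. intros Hx.
    apply Hs. rewrite Rabs_left; lra.
Qed.

(** * Improper integrals over the real line *)

(** The endpoints escape independently, as in the product filter behind [integral_R]; symmetric
    truncations are a special case. *)
Definition improper_limit (f : R -> C) (l : C) : Prop :=
  forall eps : R, 0 < eps -> exists N : R, forall a b : R,
    a < - N -> N < b -> Cmod (intC f a b - l)%C < eps.

Lemma integral_R_eq (f : R -> C) (l : C) :
  (forall x, contC f x) -> improper_limit f l -> integral_R f = l.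
Proof.
  intros Hc Hl. unfold integral_R.
  apply (is_RInt_gen_unique (V := C_R_CompleteNormedModule)).
  intros P [eps HP].
  destruct (Hl eps (cond_pos eps)) as [N HN].
  apply (Filter_prod _ _ _ (fun a => a < - N) (fun b => N < b)).
  - exists (- N). intros x Hx. exact Hx.
  - exists N. intros x Hx. exact Hx.
  - intros a b Ha Hb. exists (intC f a b). split.
    + apply ex_intC, Hc.
    + apply HP. apply (norm_compat1 (V := C_R_NormedModule)). rewrite norm_C. apply HN; assumption.
Qed.

(** The weight is chosen so that the majorant [M / (1 + x^2)] has the primitive [M * atan]: all
    tails are then differences of arctangents. *)
Definition quadratic_decay (f : R -> C) (M : R) : Prop :=
  (forall x, contC f x) /\ forall x, (1 + x ^ 2) * Cmod (f x) <= M.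

Lemma quadratic_decay_nonneg (f : R -> C) (M : R) : quadratic_decay f M -> 0 <= M.
Proof. intros [_ H]. generalize (H 0) (Cmod_ge_0 (f 0)). intros; nra. Qed.

Lemma quadratic_decay_intC (f : R -> C) (M a b : R) :
  quadratic_decay f M -> Cmod (intC f a b) <= M * Rabs (atan b - atan a).
Proof.
  intros [Hc HM].
  assert (main : forall a b, a <= b -> Cmod (intC f a b) <= M * (atan b - atan a)).
  { clear a b. intros a b Hab.
    apply (Cmod_intC_le f (fun x => M * (/ (1 + x ^ 2)))); try assumption.
    - intros x _. generalize (HM x). intros H.
      assert (0 < 1 + x ^ 2) by nra.
      apply Rmult_le_reg_l with (1 + x ^ 2); [assumption|].
      replace ((1 + x ^ 2) * (M * / (1 + x ^ 2))) with M by (field; lra). exact H.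
    - apply (is_RInt_scal (V := R_NormedModule)).
      apply (is_RInt_derive (V := R_CompleteNormedModule) atan).
      + intros x _. auto_derive; [exact I|]. unfold Rsqr. field. nra.
      + intros x _. apply continuous_Rinv_comp.
        * apply (continuous_plus (V := R_NormedModule)); [apply continuous_const|].
          apply (continuous_mult (K := R_AbsRing)); [apply continuous_id|].
          apply (continuous_mult (K := R_AbsRing)); [apply continuous_id|apply continuous_const].
        * nra. }
  destruct (Rle_lt_dec a b) as [Hab|Hab].
  - rewrite Rabs_pos_eq; [apply main, Hab|].
    destruct Hab as [Hab| ->]; [|lra]. generalize (atan_increasing a b Hab). lra.
  - replace (intC f a b) with (- intC f b a)%C.
    + rewrite Cmod_opp. rewrite Rabs_left.
      * replace (- (atan b - atan a)) with (atan a - atan b) by ring. apply main; lra.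
      * generalize (atan_increasing b a Hab). lra.
    +       generalize (intC_Chasles f a b a Hc). rewrite intC_point. intros E.
      replace (intC f a b) with ((intC f a b + intC f b a) - intC f b a)%C by ring.
      rewrite E. ring.
Qed.

Lemma atan_limit (eps : R) : 0 < eps -> exists N, forall x, N < x -> Rabs (atan x - PI / 2) < eps.
Proof.
  intros He. assert (Hpi := PI_RGT_0).
  (* The minimum keeps [PI / 2 - e] inside the range where [tan] inverts [atan]. *)
  set (e := Rmin eps (PI / 2)).
  assert (He1 : 0 < e) by (apply Rmin_glb_lt; lra).
  assert (He2 : e <= eps) by apply Rmin_l. assert (He3 : e <= PI / 2) by apply Rmin_r.
  exists (tan (PI / 2 - e)). intros x Hx.
  apply atan_increasing in Hx. rewrite atan_tan in Hx by lra.
  apply Rabs_def1; generalize (atan_bound x); lra.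
Qed.

(** Cauchy's criterion: two large intervals differ by one piece at each end, on which [atan] is
    nearly constant. *)
Lemma quadratic_decay_improper (f : R -> C) (M : R) :
  quadratic_decay f M -> exists l, improper_limit f l.
Proof.
  intros Hf. assert (HM := quadratic_decay_nonneg f M Hf). assert (Hc := proj1 Hf).
  pose (F := filter_prod (Rbar_locally m_infty) (Rbar_locally p_infty)).
  assert (Hex : exists y : C_R_CompleteNormedModule, filterlim (fun ab : R * R => intC f (fst ab) (snd ab) : C_R_CompleteNormedModule) F (locally y)).
  { apply (proj1 (filterlim_locally_cauchy (F := F) (U := C_R_CompleteNormedModule) _)).
    intros eps.
    (* On each of the two end pieces both arctangents lie within the threshold of the same limit, so
       each difference is at most twice the threshold: four in all. Using [M + 1] avoids a division
       by zero. *)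
    assert (He : 0 < eps / (4 * (M + 1))).
    { apply Rdiv_lt_0_compat; [apply cond_pos | lra]. }
    destruct (atan_limit _ He) as [N HN].
    exists (fun ab => fst ab < - N /\ N < snd ab). split.
    - apply (Filter_prod _ _ _ (fun a => a < - N) (fun b => N < b)).
      + exists (- N). intros x Hx. exact Hx.
      + exists N. intros x Hx. exact Hx.
      + intros a b Ha Hb. split; assumption.
    - intros [a b] [a' b'] [Ha Hb] [Ha' Hb']. simpl in Ha, Hb, Ha', Hb'.
      apply (norm_compat1 (V := C_R_NormedModule)). rewrite norm_C.
      change (Cmod (intC f a' b' - intC f a b)%C < eps).
      rewrite <- (intC_Chasles f a' a b' Hc), <- (intC_Chasles f a b b' Hc).
      replace (intC f a' a + (intC f a b + intC f b b') - intC f a b)%C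
        with (intC f a' a + intC f b b')%C by ring.
      assert (B1 := HN b Hb). assert (B2 := HN b' Hb').
      assert (A1 := HN (- a) ltac:(lra)). assert (A2 := HN (- a') ltac:(lra)).
      rewrite atan_opp in A1, A2.
      apply Rabs_def2 in B1, B2, A1, A2.
      eapply Rle_lt_trans; [apply Cmod_triangle|].
      eapply Rle_lt_trans; [apply Rplus_le_compat; apply quadratic_decay_intC; exact Hf|].
      rewrite <- Rmult_plus_distr_l.
      apply Rle_lt_trans with (M * (4 * (eps / (4 * (M + 1))))).
      + apply Rmult_le_compat_l; [exact HM|].
        assert (Rabs (atan a - atan a') <= 2 * (eps / (4 * (M + 1)))) by (apply Rabs_le; lra).
        assert (Rabs (atan b' - atan b) <= 2 * (eps / (4 * (M + 1)))) by (apply Rabs_le; lra).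
        lra.
      + apply Rmult_lt_reg_r with (M + 1); [lra|].
        replace (M * (4 * (eps / (4 * (M + 1)))) * (M + 1)) with (M * eps) by (field; lra).
        generalize (cond_pos eps). nra. }
  destruct Hex as [l Hl]. exists l. intros eps He.
  destruct (proj1 (filterlim_locally_ball_norm (K := R_AbsRing) (U := C_R_NormedModule) _ _) Hl (mkposreal _ He))
    as [P Q [N1 HN1] [N2 HN2] HPQ].
  exists (Rmax (- N1) N2). intros a b Ha Hb.
  rewrite <- norm_C. apply (HPQ a b).
  - apply HN1. generalize (Rmax_l (- N1) N2). lra.
  - apply HN2. generalize (Rmax_r (- N1) N2). lra.
Qed.

Lemma quadratic_decay_integral_R (f : R -> C) (M : R) :
  quadratic_decay f M -> improper_limit f (integral_R f).
Proof.
  intros Hf. destruct (quadratic_decay_improper f M Hf) as [l Hl].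
  rewrite (integral_R_eq f l (proj1 Hf) Hl). exact Hl.
Qed.

Lemma improper_limit_lin (f g : R -> C) (k lf lg : C) :
  (forall x, contC f x) -> (forall x, contC g x) ->
  improper_limit f lf -> improper_limit g lg ->
  improper_limit (fun x => f x + k * g x)%C (lf + k * lg)%C.
Proof.
  intros Cf Cg Hf Hg eps He.
  assert (Hk := Cmod_ge_0 k).
  assert (He2 : 0 < eps / (2 * (Cmod k + 1))) by (apply Rdiv_lt_0_compat; lra).
  destruct (Hf (eps / 2) ltac:(lra)) as [N1 HN1].
  destruct (Hg _ He2) as [N2 HN2].
  exists (Rmax N1 N2). intros a b Ha Hb.
  generalize (Rmax_l N1 N2) (Rmax_r N1 N2). intros H1 H2.
  rewrite intC_plus, intC_scal; try assumption.
  2: { intros x. apply continuous_Cmult; [apply continuous_const | apply Cg]. }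
  replace (intC f a b + k * intC g a b - (lf + k * lg))%C
    with ((intC f a b - lf) + k * (intC g a b - lg))%C by ring.
  eapply Rle_lt_trans; [apply Cmod_triangle|]. rewrite Cmod_mult.
  specialize (HN1 a b ltac:(lra) ltac:(lra)). specialize (HN2 a b ltac:(lra) ltac:(lra)).
  assert (Cmod k * Cmod (intC g a b - lg)%C <= Cmod k * (eps / (2 * (Cmod k + 1)))) by (apply Rmult_le_compat_l; lra).
  assert (Cmod k * (eps / (2 * (Cmod k + 1))) < eps / 2).
  { apply Rmult_lt_reg_r with (2 * (Cmod k + 1)); [lra|].
    replace (Cmod k * (eps / (2 * (Cmod k + 1))) * (2 * (Cmod k + 1))) with (Cmod k * eps) by (field; lra).
    replace (eps / 2 * (2 * (Cmod k + 1))) with (Cmod k * eps + eps) by field. lra. }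
  lra.
Qed.

(** The factor [PI] is the total increase of [atan] over the line. *)
Lemma improper_limit_bound (f : R -> C) (M : R) (l : C) :
  quadratic_decay f M -> improper_limit f l -> Cmod l <= M * PI.
Proof.
  intros Hf Hl. assert (HM := quadratic_decay_nonneg f M Hf).
  apply Rle_plus_epsilon. intros eps He.
  destruct (Hl eps He) as [N HN].
  set (b := Rabs N + 1). assert (HNb := Rle_abs N).
  specialize (HN (- b) b ltac:(unfold b; lra) ltac:(unfold b; lra)).
  replace l with (intC f (- b) b - (intC f (- b) b - l))%C by ring.
  eapply Rle_trans; [apply Cmod_triangle|]. rewrite Cmod_opp.
  apply Rplus_le_compat; [|lra].
  eapply Rle_trans; [apply quadratic_decay_intC, Hf|].
  apply Rmult_le_compat_l; [exact HM|].
  rewrite atan_opp. apply Rabs_le. generalize (atan_bound b). lra.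
Qed.

Lemma integral_R_support (f : R -> C) (K : R) :
  (forall x, contC f x) -> (forall x, K < Rabs x -> f x = 0%C) -> 0 <= K ->
  integral_R f = intC f (- K) K.
Proof.
  intros Hc Hs HK. apply integral_R_eq; [exact Hc|].
  intros eps He. exists K. intros a b Ha Hb.
  rewrite (intC_support f K a b) by (assumption || lra).
  replace (intC f (- K) K - intC f (- K) K)%C with (RtoC 0) by ring.
  rewrite Cmod_0. exact He.
Qed.

(** * Fourier transforms of rapidly decreasing functions *)

(** Derivatives are carried as witnesses, which suits complex values and lets each closure property
    exhibit its formula. *)
Fixpoint Ck1 (n : nat) (u : R -> C) : Prop :=
  match n with
  | O => forall x, contC u x
  | S n => exists du : R -> C, (forall x, derivC u x (du x)) /\ Ck1 n du
  end.

(** Only the decay of a Schwartz function is retained: it makes the Fourier transform smooth, and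
    the class is stable under multiplication by [x]. *)
Definition rapid (f : R -> C) : Prop :=
  (forall x, contC f x) /\ forall k : nat, exists M : R, forall x : R, Rabs x ^ k * Cmod (f x) <= M.

Lemma Cmod_Ci : Cmod Ci = 1.
Proof.
  unfold Cmod, Ci; simpl. replace (0 * (0 * 1) + 1 * (1 * 1)) with 1 by ring. apply sqrt_1.
Qed.

Lemma Cmod_le_Re_Im (z : C) : Cmod z <= Rabs (Re z) + Rabs (Im z).
Proof.
  destruct z as [p q]. simpl.
  replace ((p, q) : C) with (RtoC p + RtoC q * Ci)%C by (apply injective_projections; simpl; ring).
  eapply Rle_trans; [apply Cmod_triangle|]. rewrite Cmod_mult, !Cmod_R.
  rewrite Cmod_Ci. lra.
Qed.

Lemma schwartz_R_continuous (f : R -> R) (x : R) : schwartz_R f -> continuous f x.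
Proof. intros [H _]. apply (ex_derive_continuous (V := R_NormedModule)). apply (H 1%nat x). Qed.

Lemma schwartz_rapid (f : R -> C) : schwartz f -> rapid f.
Proof.
  intros [H1 H2]. split.
  - intros x. apply (continuous_ext (U := C_R_NormedModule) (fun t => (Re (f t), Im (f t)) : C)).
    + intros t. symmetry. apply surjective_pairing.
    + apply continuous_C_pair; apply schwartz_R_continuous; assumption.
  - intros k. destruct (proj2 H1 0%nat k) as [M1 HM1]. destruct (proj2 H2 0%nat k) as [M2 HM2].
    exists (M1 + M2). intros x. specialize (HM1 x). specialize (HM2 x).
    rewrite Rabs_mult, <- RPow_abs in HM1, HM2. simpl in HM1, HM2.
    eapply Rle_trans; [apply Rmult_le_compat_l; [apply pow_le, Rabs_pos | apply Cmod_le_Re_Im]|].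
    lra.
Qed.

Lemma rapid_times_x (f : R -> C) (k : C) : rapid f -> rapid (fun x => k * RtoC x * f x)%C.
Proof.
  intros [Hc Hd]. split.
  - intros x. apply continuous_Cmult; [|apply Hc].
    apply continuous_Cmult; [apply continuous_const | apply continuous_RtoC, continuous_id].
  - intros n. destruct (Hd (S n)) as [M HM]. exists (Cmod k * M). intros x.
    rewrite !Cmod_mult, Cmod_R. specialize (HM x). simpl in HM.
    replace (Rabs x ^ n * (Cmod k * Rabs x * Cmod (f x))) with (Cmod k * (Rabs x * Rabs x ^ n * Cmod (f x))) by ring.
    apply Rmult_le_compat_l; [apply Cmod_ge_0 | exact HM].
Qed.

Lemma rapid_quadratic_decay (f : R -> C) : rapid f -> exists M, quadratic_decay f M.
Proof.
  intros [Hc Hd]. destruct (Hd 0%nat) as [M0 H0]. destruct (Hd 2%nat) as [M2 H2].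
  exists (M0 + M2). split; [exact Hc|]. intros x. specialize (H0 x). specialize (H2 x).
  rewrite RPow_abs, (Rabs_pos_eq (x ^ 2)) in H2 by nra. simpl in *. lra.
Qed.

Lemma quadratic_decay_cis (f : R -> C) (u : R -> R) (M : R) :
  (forall x, continuous u x) -> quadratic_decay f M -> quadratic_decay (fun x => cis (u x) * f x)%C M.
Proof.
  intros Hu [Hc Hd]. split.
  - intros x. apply continuous_Cmult; [apply continuous_cis, Hu | apply Hc].
  - intros x. rewrite Cmod_mult, Cmod_cis, Rmult_1_l. apply Hd.
Qed.

Lemma Rabs_square (x : R) : Rabs x * Rabs x = x ^ 2.
Proof. rewrite <- Rabs_mult, Rabs_pos_eq; [ring | apply Rle_0_sqr]. Qed.

Lemma continuous_mul_l (k x : R) : continuous (fun y : R => k * y) x.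
Proof. apply (continuous_mult (K := R_AbsRing)); [apply continuous_const | apply continuous_id]. Qed.

Lemma continuous_opp_mul_r (k x : R) : continuous (fun y : R => - (y * k)) x.
Proof.
  apply (continuous_opp (V := R_NormedModule)).
  apply (continuous_mult (K := R_AbsRing)); [apply continuous_id | apply continuous_const].
Qed.

Lemma cis_minus_1 (t : R) : (cis t - 1)%C = intC (fun s => Ci * RtoC t * cis (t * s))%C 0 1.
Proof.
  rewrite (intC_derive (fun s => cis (t * s))).
  - rewrite Rmult_0_r, Rmult_1_r, cis_0. reflexivity.
  - intros x. apply (is_derive_cis (fun s => t * s)). auto_derive; [exact I | ring].
  - intros x. apply continuous_Cmult; [apply continuous_const|].
    apply continuous_cis. apply continuous_mul_l.
Qed.

Lemma cis_order1 (t : R) : Cmod (cis t - 1)%C <= Rabs t.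
Proof.
  rewrite cis_minus_1. replace (Rabs t) with ((1 - 0) * Rabs t) by ring.
  apply Cmod_intC_le_const; [lra | |].
  - intros x. apply continuous_Cmult; [apply continuous_const|].
    apply continuous_cis. apply continuous_mul_l.
  - intros x _. rewrite !Cmod_mult, Cmod_cis, Cmod_Ci, Cmod_R. lra.
Qed.

(** The remainder is the integral of [i t (cis (t s) - 1)] over [(0, 1)], to which the first-order
    bound applies. The sharp constant [1 / 2] is not pursued. *)
Lemma cis_order2 (t : R) : Cmod (cis t - 1 - Ci * RtoC t)%C <= t ^ 2.
Proof.
  assert (Hc : forall x, contC (fun s => cis (t * s)) x).
  { intros x. apply continuous_cis. apply continuous_mul_l. }
  replace (cis t - 1 - Ci * RtoC t)%C with (intC (fun s => Ci * RtoC t * (cis (t * s) - 1))%C 0 1).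
  - replace (t ^ 2) with ((1 - 0) * t ^ 2) by ring.
    apply Cmod_intC_le_const; [lra | |].
    + intros x. apply continuous_Cmult; [apply continuous_const|].
      apply continuous_Cminus; [apply Hc | apply continuous_const].
    + intros x Hx. rewrite !Cmod_mult, Cmod_Ci, Cmod_R, Rmult_1_l.
      rewrite <- Rabs_square.
      apply Rmult_le_compat_l; [apply Rabs_pos|].
      eapply Rle_trans; [apply cis_order1|]. rewrite Rabs_mult.
      rewrite (Rabs_pos_eq x) by lra. generalize (Rabs_pos t). nra.
  - apply intC_unique.
    rewrite cis_minus_1.
    apply (is_RInt_ext (V := C_R_NormedModule) (fun s => Ci * RtoC t * cis (t * s) - Ci * RtoC t)%C).
    + intros x _. simpl. ring.
    + apply (is_RInt_minus (V := C_R_NormedModule)).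
      * apply ex_intC. intros x. apply continuous_Cmult; [apply continuous_const | apply Hc].
      * generalize (is_RInt_const (V := C_R_NormedModule) 0 1 (Ci * RtoC t)%C).
        replace (1 - 0) with 1 by ring. rewrite (scal_one (V := C_R_NormedModule)). intros H; exact H.
Qed.

(** A quadratic remainder divided by [h] tends to zero. The sign of [M] is left free, whence the
    radius [eps / (Rabs M + 1)]. *)
Lemma is_derive_quadratic (f : R -> C) (x M : R) (l : C) :
  (forall h : R, Cmod (f (x + h)%R - f x - RtoC h * l)%C <= M * h ^ 2) -> derivC f x l.
Proof.
  intros H. split; [apply (is_linear_scal_l (V := C_R_NormedModule))|].
  intros x0 Hx0. rewrite <- (is_filter_lim_locally_unique _ _ Hx0). clear x0 Hx0.
  intros eps.
  assert (HM := Rabs_pos M).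
  assert (He : 0 < eps / (Rabs M + 1)) by (apply Rdiv_lt_0_compat; [apply cond_pos | lra]).
  exists (mkposreal _ He). intros y Hy.
  change (Rabs (y - x) < eps / (Rabs M + 1)) in Hy.
  rewrite norm_C. change (norm (minus y x)) with (Rabs (y - x)).
  replace (Cmod _) with (Cmod (f (x + (y - x))%R - f x - RtoC (y - x) * l)%C).
  - eapply Rle_trans; [apply H|].
    rewrite <- Rabs_square.
    rewrite <- Rmult_assoc. apply Rmult_le_compat_r; [apply Rabs_pos|].
    apply Rle_trans with (Rabs M * Rabs (y - x)).
    + apply Rmult_le_compat_r; [apply Rabs_pos | apply Rle_abs].
    + apply Rle_trans with (Rabs M * (eps / (Rabs M + 1))); [apply Rmult_le_compat_l; lra|].
      apply Rmult_le_reg_r with (Rabs M + 1); [lra|].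
      replace (Rabs M * (eps / (Rabs M + 1)) * (Rabs M + 1)) with (Rabs M * eps) by (field; lra).
      generalize (cond_pos eps). nra.
  - f_equal. rewrite (Rplus_minus x y).
    apply injective_projections; unfold minus, plus, opp, scal; simpl;
      unfold prod_plus, prod_opp, prod_scal, plus, opp, scal; simpl; unfold mult; simpl; ring.
Qed.

Lemma fourier_improper (f : R -> C) (xi : R) :
  rapid f -> improper_limit (fun x => cis (- (x * xi)) * f x)%C (fourier f xi).
Proof.
  intros Hf. destruct (rapid_quadratic_decay f Hf) as [M HM].
  apply (quadratic_decay_integral_R _ M). apply (quadratic_decay_cis f (fun x => - (x * xi))); [|exact HM].
  intros x. apply continuous_opp_mul_r.
Qed.

(** Differentiation under an improper integral, by a pointwise Taylor bound instead of dominated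
    convergence: the remainder has integrand [cis (- (x * xi)) f(x) (e^(-ixh) - 1 + ixh)], of
    modulus at most [h^2 x^2 |f(x)|]. *)
Lemma is_derive_fourier (f : R -> C) (xi : R) :
  rapid f -> derivC (fourier f) xi (fourier (fun x => - Ci * RtoC x * f x)%C xi).
Proof.
  intros Hf. assert (Hg := rapid_times_x f (- Ci) Hf).
  (* The factor [x^2] lost to the Taylor remainder is absorbed here: [x^2 f] still decays
     quadratically, with constant [M]. *)
  assert (Hff := rapid_times_x _ 1 (rapid_times_x f 1 Hf)).
  destruct (rapid_quadratic_decay _ Hff) as [M [_ HM]].
  assert (Cc : forall k x, contC (fun x => cis (- (x * k))) x).
  { intros k x. apply continuous_cis. apply continuous_opp_mul_r. }
  apply is_derive_quadratic with (M * PI). intros h.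
  set (D := fourier (fun x => - Ci * RtoC x * f x)%C xi).
  (* Both values of the transform and the candidate derivative are gathered under one improper
     integral, so that cancellation happens before the modulus is taken. *)
  assert (L : improper_limit (fun x => (cis (- (x * (xi + h))) * f x + (- (1)) * (cis (- (x * xi)) * f x)) + (- RtoC h) * (cis (- (x * xi)) * (- Ci * RtoC x * f x)))%C
     ((fourier f (xi + h)%R + (- (1)) * fourier f xi) + (- RtoC h) * D)%C).
  { apply improper_limit_lin.
    - intros x. apply continuous_Cplus; [|apply continuous_Cmult; [apply continuous_const|]];
      (apply continuous_Cmult; [apply Cc | apply (proj1 Hf)]).
    - intros x. apply continuous_Cmult; [apply Cc | apply (proj1 Hg)].
    - apply improper_limit_lin.
      + intros x. apply continuous_Cmult; [apply Cc | apply (proj1 Hf)].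
      + intros x. apply continuous_Cmult; [apply Cc | apply (proj1 Hf)].
      + apply fourier_improper, Hf.
      + apply fourier_improper, Hf.
    - apply fourier_improper, Hg. }
  replace (fourier f (xi + h)%R - fourier f xi - RtoC h * D)%C
    with ((fourier f (xi + h)%R + (- (1)) * fourier f xi) + (- RtoC h) * D)%C by ring.
  replace (M * PI * h ^ 2) with (M * h ^ 2 * PI) by ring.
  apply improper_limit_bound with (2 := L). split.
  - intros x. apply continuous_Cplus.
    + apply continuous_Cplus; [|apply continuous_Cmult; [apply continuous_const|]];
      (apply continuous_Cmult; [apply Cc | apply (proj1 Hf)]).
    + apply continuous_Cmult; [apply continuous_const|].
      apply continuous_Cmult; [apply Cc | apply (proj1 Hg)].
  - intros x. specialize (HM x).
    replace (cis (- (x * (xi + h)))) with (cis (- (x * xi)) * cis (- (x * h)))%C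
      by (rewrite <- cis_plus; f_equal; ring).
    replace (_ + _ + _)%C with (cis (- (x * xi)) * (f x * (cis (- (x * h)) - 1 - Ci * RtoC (- (x * h)))))%C.
    + rewrite !Cmod_mult, Cmod_cis, Rmult_1_l.
      rewrite !Cmod_mult, !Cmod_R, Rabs_R1, !Rmult_1_l in HM.
      assert (E := cis_order2 (- (x * h))).
      assert (Hm := Cmod_ge_0 (f x)).
      apply Rle_trans with ((1 + x ^ 2) * (Cmod (f x) * (- (x * h)) ^ 2)).
      * apply Rmult_le_compat_l; [nra|]. apply Rmult_le_compat_l; assumption.
      * replace ((1 + x ^ 2) * (Cmod (f x) * (- (x * h)) ^ 2))
          with ((1 + x ^ 2) * ((x * x) * Cmod (f x)) * h ^ 2) by ring.
        apply Rmult_le_compat_r; [nra|].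
        replace (x * x) with (Rabs x * Rabs x) by (rewrite Rabs_square; ring).
        rewrite (Rmult_assoc (Rabs x)). exact HM.
    + rewrite RtoC_opp, RtoC_mult. ring.
Qed.

(** The derivative is the transform of [- i x f], again rapidly decreasing, so the induction runs
    over all such [f] at once. *)
Lemma Ck1_fourier (n : nat) (f : R -> C) : rapid f -> Ck1 n (fourier f).
Proof.
  revert f. induction n as [|n IH]; intros f Hf; simpl.
  - intros x. eapply is_derive_continuousC. apply is_derive_fourier, Hf.
  - eexists. split.
    + intros x. apply is_derive_fourier, Hf.
    + apply (IH (fun x => - Ci * RtoC x * f x)%C). apply rapid_times_x, Hf.
Qed.

(** * Differentiability classes *)

(** Both partial derivatives are required to be in the preceding class, so mixed derivatives are
    available and jointly continuous; [double_oscillation_bound] consumes one of them. *)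
Fixpoint Ck (n : nat) (h : R -> R -> C) : Prop :=
  match n with
  | O => contC2 h
  | S n => contC2 h /\ exists hx hy : R -> R -> C,
      (forall x y, derivC (fun x' => h x' y) x (hx x y)) /\
      (forall x y, derivC (h x) y (hy x y)) /\ Ck n hx /\ Ck n hy
  end.

Lemma Ck_continuous (n : nat) (h : R -> R -> C) : Ck n h -> contC2 h.
Proof. destruct n; simpl; tauto. Qed.

Lemma Ck_pred (n : nat) (h : R -> R -> C) : Ck (S n) h -> Ck n h.
Proof.
  revert h. induction n as [|n IH]; intros h.
  - apply Ck_continuous.
  - intros [H [hx [hy [H1 [H2 [H3 H4]]]]]].
    split; [exact H|]. exists hx, hy. auto.
Qed.

Lemma Ck_ext (n : nat) (g h : R -> R -> C) : (forall x y, g x y = h x y) -> Ck n g -> Ck n h.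
Proof.
  intros E. replace h with g; [tauto|].
  do 2 (apply functional_extensionality; intros). apply E.
Qed.

Lemma Ck_const (n : nat) (k : C) : Ck n (fun _ _ => k).
Proof.
  revert k. induction n as [|n IH]; intros k.
  - intros p. apply continuous_const.
  - split; [intros p; apply continuous_const|].
    exists (fun _ _ => RtoC 0), (fun _ _ => RtoC 0).
    split; [|split; [|split; apply IH]]; intros; apply (is_derive_const (V := C_R_NormedModule)).
Qed.

Lemma Ck_plus (n : nat) (g h : R -> R -> C) : Ck n g -> Ck n h -> Ck n (fun x y => g x y + h x y)%C.
Proof.
  revert g h. induction n as [|n IH]; intros g h.
  - intros Hg Hh p. apply continuous_Cplus; auto.
  - intros [Hg [gx [gy [G1 [G2 [G3 G4]]]]]] [Hh [hx [hy [H1 [H2 [H3 H4]]]]]].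
    split; [intros p; apply continuous_Cplus; auto|].
    exists (fun x y => gx x y + hx x y)%C, (fun x y => gy x y + hy x y)%C.
    split; [|split; [|split; auto]]; intros x y; apply (is_derive_plus (V := C_R_NormedModule)); auto.
Qed.

Lemma Ck_mult (n : nat) (g h : R -> R -> C) : Ck n g -> Ck n h -> Ck n (fun x y => g x y * h x y)%C.
Proof.
  revert g h. induction n as [|n IH]; intros g h.
  - intros Hg Hh p. apply continuous_Cmult; auto.
  - intros Hg' Hh'. assert (Pg := Ck_pred _ _ Hg'). assert (Ph := Ck_pred _ _ Hh').
    destruct Hg' as [Hg [gx [gy [G1 [G2 [G3 G4]]]]]]. destruct Hh' as [Hh [hx [hy [H1 [H2 [H3 H4]]]]]].
    split; [intros p; apply continuous_Cmult; auto|].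
    exists (fun x y => gx x y * h x y + g x y * hx x y)%C, (fun x y => gy x y * h x y + g x y * hy x y)%C.
    split; [|split; [|split]].
    + intros x y. apply (is_derive_Cmult (fun x' => g x' y) (fun x' => h x' y)); auto.
    + intros x y. apply (is_derive_Cmult (g x) (h x)); auto.
    + apply Ck_plus; apply IH; assumption.
    + apply Ck_plus; apply IH; assumption.
Qed.

Lemma continuous_lin2 {T : UniformSpace} (p q : R) (u v : T -> R) (x : T) :
  continuous u x -> continuous v x -> continuous (fun t => p * u t + q * v t) x.
Proof.
  intros Hu Hv. apply (continuous_plus (V := R_NormedModule));
  apply (continuous_mult (K := R_AbsRing)); try assumption; apply continuous_const.
Qed.

Lemma is_derive_C_comp (u : R -> C) (v : R -> R) (k x : R) (l : C) :
  derivC u (v x) l -> is_derive v x k -> derivC (fun t => u (v t)) x (RtoC k * l)%C.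
Proof.
  intros Hu Hv. replace (RtoC k * l)%C with (scal k (l : C_R_NormedModule)).
  - apply (is_derive_comp (V := C_R_NormedModule) u v); assumption.
  - apply injective_projections; unfold scal; simpl; unfold prod_scal, scal; simpl; unfold mult; simpl; ring.
Qed.

Lemma Ck1_continuous (n : nat) (u : R -> C) (x : R) : Ck1 n u -> contC u x.
Proof.
  destruct n; simpl; [auto|]. intros [du [H1 _]]. eapply is_derive_continuousC, H1.
Qed.

(** Linear forms cover every one-variable ingredient at once: functions of [xi], of [eta] and of
    [xi + eta]. *)
Lemma Ck_lin (n : nat) (u : R -> C) (p q : R) : Ck1 n u -> Ck n (fun x y => u (p * x + q * y)).
Proof.
  revert u. induction n as [|n IH]; intros u Hu.
  - intros z. apply (continuous_comp (fun z : R * R => p * fst z + q * snd z) u); [|apply Hu].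
    destruct z. apply continuous_lin2; [apply continuous_fst | apply continuous_snd].
  - assert (C0 := fun x => Ck1_continuous _ _ x Hu). destruct Hu as [du [H1 H2]]. split.
    + intros z. apply (continuous_comp (fun z : R * R => p * fst z + q * snd z) u); [|apply C0].
      destruct z. apply continuous_lin2; [apply continuous_fst | apply continuous_snd].
    + exists (fun x y => RtoC p * du (p * x + q * y)%R)%C, (fun x y => RtoC q * du (p * x + q * y)%R)%C.
      split; [|split; [|split]].
      * intros x y. apply (is_derive_C_comp u (fun x => p * x + q * y)); [apply H1|].
        auto_derive; [exact I | ring].
      * intros x y. apply (is_derive_C_comp u (fun y => p * x + q * y)); [apply H1|].
        auto_derive; [exact I | ring].
      * apply Ck_mult; [apply Ck_const | apply IH, H2].
      * apply Ck_mult; [apply Ck_const | apply IH, H2].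
Qed.

(** For a real function the witnesses inside [Ck] are a priori complex; this recovers a real
    derivative from them. *)
Lemma is_derive_of_RtoC (u : R -> R) (x : R) (l : C) :
  derivC (fun t => RtoC (u t)) x l -> is_derive u x (Re l) /\ l = RtoC (Re l).
Proof.
  intros H. split; [apply (is_derive_Re _ _ _ H)|].
  apply (is_derive_C_unique _ _ _ _ H). apply is_derive_RtoC. apply (is_derive_Re _ _ _ H).
Qed.

Lemma Ck_cis (n : nat) (u : R -> R -> R) :
  Ck n (fun x y => RtoC (u x y)) -> Ck n (fun x y => cis (u x y)).
Proof.
  induction n as [|n IH].
  - intros H p. apply continuous_cis. apply (continuous_Re _ _ (H p)).
  - intros Hu. assert (P := IH (Ck_pred _ _ Hu)).
    destruct Hu as [Hu [ux [uy [H1 [H2 [H3 H4]]]]]]. split.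
    + intros p. apply continuous_cis. apply (continuous_Re _ _ (Hu p)).
    + exists (fun x y => Ci * ux x y * cis (u x y))%C, (fun x y => Ci * uy x y * cis (u x y))%C.
      split; [|split; [|split]].
      * intros x y. destruct (is_derive_of_RtoC (fun x' => u x' y) x _ (H1 x y)) as [D E].
        rewrite E. apply (is_derive_cis (fun x' => u x' y)), D.
      * intros x y. destruct (is_derive_of_RtoC (u x) y _ (H2 x y)) as [D E].
        rewrite E. apply (is_derive_cis (u x)), D.
      * apply Ck_mult; [apply Ck_mult; [apply Ck_const | exact H3] | exact P].
      * apply Ck_mult; [apply Ck_mult; [apply Ck_const | exact H4] | exact P].
Qed.

(** * Supports, and regularity of quotients and of smooth symbols *)

Lemma not_in_supp (m : R -> R -> C) (x y : R) :
  ~ in_supp m x y -> exists eps : posreal, forall x' y',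
    Rabs (x' - x) < eps -> Rabs (y' - y) < eps -> m x' y' = 0%C.
Proof.
  intros H. apply NNPP. intros N. apply H. intros eps He.
  apply NNPP. intros N'. apply N. exists (mkposreal eps He). intros x' y' Hx Hy.
  apply NNPP. intros N''. apply N'. exists x', y'. auto.
Qed.

Lemma is_derive_locally_zero (f : R -> C) (x : R) (eps : posreal) :
  (forall x', Rabs (x' - x) < eps -> f x' = 0%C) -> derivC f x (RtoC 0).
Proof.
  intros H. apply (is_derive_ext_loc (V := C_R_NormedModule) (fun _ => RtoC 0)).
  - exists eps. intros y Hy. symmetry. apply H, Hy.
  - apply (is_derive_const (V := C_R_NormedModule)).
Qed.

(** Differentiation does not enlarge supports. The expression is the numerator of the quotient rule,
    for which nonvanishing of the denominator has to be known again at the next order. *)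
Lemma in_supp_derivatives (m mx p q : R -> R -> C) (x y : R) :
  (forall x y, derivC (fun x' => m x' y) x (mx x y)) \/ (forall x y, derivC (m x) y (mx x y)) ->
  in_supp (fun x y => mx x y * p x y - m x y * q x y)%C x y -> in_supp m x y.
Proof.
  intros Hm Hs. apply NNPP. intros N. destruct (not_in_supp _ _ _ N) as [eps He].
  destruct (Hs eps (cond_pos eps)) as [x' [y' [Hx [Hy Hne]]]]. apply Hne.
  rewrite (He x' y' Hx Hy).
  replace (mx x' y') with (RtoC 0); [ring|].
  destruct Hm as [Hm|Hm].
  (* The room left around [x'] inside the interval of radius [eps] about [x], where the function of
     the first variable is identically zero. *)
  - assert (Hd : 0 < eps - Rabs (x' - x)) by lra.
    apply (is_derive_C_unique (fun x' => m x' y') x'); [|apply Hm].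
    apply (is_derive_locally_zero (fun x' => m x' y') x' (mkposreal _ Hd)). simpl.
    intros z Hz. apply He; [|exact Hy].
    replace (z - x) with ((z - x') + (x' - x)) by ring.
    eapply Rle_lt_trans; [apply Rabs_triang|]. lra.
  - assert (Hd : 0 < eps - Rabs (y' - y)) by lra.
    apply (is_derive_C_unique (m x') y'); [|apply Hm].
    apply (is_derive_locally_zero (m x') y' (mkposreal _ Hd)). simpl.
    intros z Hz. apply He; [exact Hx|].
    replace (z - y) with ((z - y') + (y' - y)) by ring.
    eapply Rle_lt_trans; [apply Rabs_triang|]. lra.
Qed.

Lemma is_derive_Cdiv_real (f : R -> C) (u : R -> R) (x : R) (df du : C) :
  u x <> 0 -> derivC f x df -> derivC (fun t => RtoC (u t)) x du ->
  derivC (fun t => f t / RtoC (u t))%C x ((df * RtoC (u x) - f x * du) / RtoC (u x * u x))%C.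
Proof.
  intros Hn Hf Hu. destruct (is_derive_of_RtoC u x du Hu) as [Du E].
  apply (is_derive_ext_loc (V := C_R_NormedModule) (fun t => (f t * RtoC (/ u t))%C)).
  (* Replacing the quotient by a product with a real inverse is justified where [u] does not vanish,
     which by continuity holds near [x]. *)
  - assert (Cu : continuous u x) by (apply (ex_derive_continuous (V := R_NormedModule)); eexists; exact Du).
    generalize (Cu (fun z => z <> 0) (open_neq 0 (u x) Hn)).
    unfold filtermap. apply filter_imp.
    intros t Ht. rewrite RtoC_inv by exact Ht. reflexivity.
  - replace ((df * RtoC (u x) - f x * du) / RtoC (u x * u x))%C
      with (df * RtoC (/ u x) + f x * RtoC (- Re du / u x ^ 2))%C.
    + apply (is_derive_Cmult f (fun t => RtoC (/ u t))); [exact Hf|]. apply (is_derive_RtoC (fun t => / u t)).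
      apply (is_derive_inv u x (Re du) Du Hn).
    + rewrite E at 2. simpl Re at 2. unfold Rdiv.
      rewrite !RtoC_mult, RtoC_opp, !RtoC_inv by (try apply pow_nonzero; exact Hn).
      rewrite RtoC_pow. field. intros E0. apply Hn. apply (f_equal Re) in E0. exact E0.
Qed.

(* Off the support of [m] the quotient is [0] even where [p] vanishes, since [0 * / 0 = 0]. *)
Lemma Ck_div (n : nat) (m : R -> R -> C) (p : R -> R -> R) :
  Ck n m -> Ck n (fun x y => RtoC (p x y)) ->
  (forall x y, in_supp m x y -> p x y <> 0) -> Ck n (fun x y => m x y / RtoC (p x y))%C.
Proof.
  assert (cont : forall (m : R -> R -> C) p, contC2 m -> contC2 (fun x y => RtoC (p x y)) ->
    (forall x y, in_supp m x y -> p x y <> 0) -> contC2 (fun x y => m x y / RtoC (p x y))%C).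
  { clear. intros m p Hm Hp Hs [x y].
    destruct (classic (in_supp m x y)) as [Hin|Hout].
    - apply continuous_Cmult; [apply Hm|]. apply continuous_Cinv; [|apply Hp].
      simpl. intros E. apply (f_equal Re) in E. exact (Hs x y Hin E).
    - destruct (not_in_supp _ _ _ Hout) as [eps He].
      apply (continuous_ext_loc (U := C_R_NormedModule) _ (fun _ => RtoC 0)); [|apply continuous_const].
      exists eps. intros [x' y'] [Hx Hy]. simpl. rewrite (He x' y' Hx Hy).
      unfold Cdiv. symmetry. apply Cmult_0_l. }
  revert m p. induction n as [|n IH]; intros m p; [apply cont|].
  intros Hm' Hp' Hs. assert (Pm := Ck_pred _ _ Hm'). assert (Pp := Ck_pred _ _ Hp').
  destruct Hm' as [Hm [mx [my [M1 [M2 [M3 M4]]]]]]. destruct Hp' as [Hp [px [py [P1 [P2 [P3 P4]]]]]].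
  split; [apply cont; assumption|].
  exists (fun x y => (mx x y * RtoC (p x y) - m x y * px x y) / RtoC (p x y * p x y))%C,
         (fun x y => (my x y * RtoC (p x y) - m x y * py x y) / RtoC (p x y * p x y))%C.
  assert (Hpp : Ck n (fun x y => RtoC (p x y * p x y))).
  { apply (Ck_ext n (fun x y => RtoC (p x y) * RtoC (p x y))%C); [intros; rewrite RtoC_mult; reflexivity|].
    apply Ck_mult; assumption. }
  split; [|split; [|split]].
  - intros x y. destruct (classic (in_supp m x y)) as [Hin|Hout].
    + apply (is_derive_Cdiv_real (fun x' => m x' y) (fun x' => p x' y)); auto.
    + destruct (not_in_supp _ _ _ Hout) as [eps He].
      assert (E0 : forall x', Rabs (x' - x) < eps -> m x' y = 0%C).
      { intros x' Hx. apply He; [exact Hx|]. rewrite Rminus_diag, Rabs_R0. apply cond_pos. }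
      replace (mx x y) with (RtoC 0).
      * rewrite E0 by (rewrite Rminus_diag, Rabs_R0; apply cond_pos).
        replace (_ / _)%C with (RtoC 0) by (unfold Cdiv; ring).
        apply (is_derive_locally_zero _ x eps). intros x' Hx. rewrite E0 by exact Hx. unfold Cdiv; ring.
      * apply (is_derive_C_unique (fun x' => m x' y) x); [|apply M1].
        apply (is_derive_locally_zero _ x eps). exact E0.
  - intros x y. destruct (classic (in_supp m x y)) as [Hin|Hout].
    + apply (is_derive_Cdiv_real (m x) (p x)); auto.
    + destruct (not_in_supp _ _ _ Hout) as [eps He].
      assert (E0 : forall y', Rabs (y' - y) < eps -> m x y' = 0%C).
      { intros y' Hy. apply He; [|exact Hy]. rewrite Rminus_diag, Rabs_R0. apply cond_pos. }
      replace (my x y) with (RtoC 0).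
      * rewrite E0 by (rewrite Rminus_diag, Rabs_R0; apply cond_pos).
        replace (_ / _)%C with (RtoC 0) by (unfold Cdiv; ring).
        apply (is_derive_locally_zero _ y eps). intros y' Hy. rewrite E0 by exact Hy. unfold Cdiv; ring.
      * apply (is_derive_C_unique (m x) y); [|apply M2].
        apply (is_derive_locally_zero _ y eps). exact E0.
  (* The derivative is again a quotient, of the quotient-rule numerator by [p * p], and the support
     of that numerator lies in the support of [m]: this closes the induction. *)
  - apply IH; [|exact Hpp|].
    + apply (Ck_ext n (fun x y => mx x y * RtoC (p x y) + (- (1)) * (m x y * px x y))%C); [intros; ring|].
      apply Ck_plus; [apply Ck_mult; assumption|].
      apply Ck_mult; [apply Ck_const | apply Ck_mult; assumption].
    + intros x y Hin. apply Rmult_integral_contrapositive_currified; apply Hs;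
      apply (in_supp_derivatives m mx (fun x y => RtoC (p x y)) px x y (or_introl M1) Hin).
  - apply IH; [|exact Hpp|].
    + apply (Ck_ext n (fun x y => my x y * RtoC (p x y) + (- (1)) * (m x y * py x y))%C); [intros; ring|].
      apply Ck_plus; [apply Ck_mult; assumption|].
      apply Ck_mult; [apply Ck_const | apply Ck_mult; assumption].
    + intros x y Hin. apply Rmult_integral_contrapositive_currified; apply Hs;
      apply (in_supp_derivatives m my (fun x y => RtoC (p x y)) py x y (or_intror M2) Hin).
Qed.

Lemma Ck_smooth2 (n : nat) (m : R -> R -> C) : smooth2 m -> Ck n m.
Proof.
  intros [Hr Hi].
  set (p := fun x y => Re (m x y)). set (q := fun x y => Im (m x y)).
  (* Generalised over the list [s] of derivatives already taken, since each partial derivative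
     prepends an entry. *)
  assert (main : forall n s, Ck n (fun x y => (ipartial s p x y, ipartial s q x y))).
  { clear n. induction n as [|n IH]; intros s.
    - intros [x y]. apply continuous_C_pair; [apply (proj2 (Hr s)) | apply (proj2 (Hi s))].
    - split.
      + intros [x y]. apply continuous_C_pair; [apply (proj2 (Hr s)) | apply (proj2 (Hi s))].
      + exists (fun x y => (ipartial (true :: s) p x y, ipartial (true :: s) q x y)),
               (fun x y => (ipartial (false :: s) p x y, ipartial (false :: s) q x y)).
        split; [|split; [|split; apply IH]].
        * intros x y.
          exact (is_derive_C_pair _ _ _ _ _ (Derive_correct _ _ (proj1 (proj1 (Hr s) x y)))
                   (Derive_correct _ _ (proj1 (proj1 (Hi s) x y)))).
        * intros x y.
          exact (is_derive_C_pair _ _ _ _ _ (Derive_correct _ _ (proj2 (proj1 (Hr s) x y)))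
                   (Derive_correct _ _ (proj2 (proj1 (Hi s) x y)))). }
  apply (Ck_ext n (fun x y => (ipartial nil p x y, ipartial nil q x y))); [|apply main].
  intros x y. symmetry. apply surjective_pairing.
Qed.

Lemma Ck1_smooth (n : nat) (a : R -> R) : smooth a -> Ck1 n (fun x => RtoC (a x)).
Proof.
  intros Ha.
  assert (main : forall n k, Ck1 n (fun x => RtoC (Derive_n a k x))).
  { clear n. induction n as [|n IH]; intros k.
    - intros x. apply continuous_RtoC. apply (ex_derive_continuous (V := R_NormedModule)). apply (Ha (S k)).
    - exists (fun x => RtoC (Derive_n a (S k) x)). split; [|apply IH].
      intros x. apply is_derive_RtoC. apply Derive_correct. apply (Ha (S k)). }
  apply (main n 0%nat).
Qed.

(** The integral collects [M] over the antidiagonal [xi + eta = z]: it is the density of a bilinear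
    multiplier in the output frequency. The limits are fixed and [z] enters only the first slot of
    [M]. *)
Lemma Ck1_convolution (n : nat) (M : R -> R -> C) (K : R) :
  Ck n M -> Ck1 n (fun z => intC (fun y => M (z - y) y) (- K) K).
Proof.
  assert (cs : forall M, contC2 M -> contC2 (fun z y => M (z - y) y)).
  { intros M0 HM [z y]. apply (contC2_comp M0 (fun q : R * R => fst q - snd q) snd); [exact HM| |apply continuous_snd].
    apply (continuous_minus (V := R_NormedModule)); [apply continuous_fst | apply continuous_snd]. }
  revert M. induction n as [|n IH]; intros M HM.
  - intros z. apply (continuous_intC_param (fun z y => M (z - y) y)). apply cs, HM.
  - destruct HM as [HM [Mx [My [H1 [H2 [H3 H4]]]]]].
    exists (fun z => intC (fun y => Mx (z - y) y) (- K) K). split; [|apply IH, H3].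
    intros z. apply (is_derive_intC_param (fun z y => M (z - y) y) (fun z y => Mx (z - y) y)).
    + intros x y. replace (Mx (x - y) y) with (RtoC 1 * Mx (x - y)%R y)%C by ring.
      apply (is_derive_C_comp (fun x' => M x' y) (fun x => x - y)); [apply H1|].
      auto_derive; [exact I | ring].
    + intros x y. apply (contC2_r (fun z y => M (z - y) y)). apply cs, HM.
    + apply cs. apply (Ck_continuous n), H3.
Qed.

(** * Van der Corput's lemma *)

Lemma mean_value_lower (f df : R -> R) (k a b : R) :
  (forall x, is_derive f x (df x)) -> (forall x, k <= df x) -> a <= b -> k * (b - a) <= f b - f a.
Proof.
  intros Hd Hk Hab. destruct (MVT_gen f a b df) as [c [_ Hc]].
  - intros x _. apply Hd.
  - intros x _. apply continuity_pt_filterlim. apply (ex_derive_continuous (V := R_NormedModule)).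
    eexists. apply Hd.
  - rewrite Hc. apply Rmult_le_compat_r; [lra | apply Hk].
Qed.

(** Van der Corput's first derivative test. The trial primitive [- i e^(i Phi) / Phi'] has an error
    of modulus [Phi'' / Phi'^2], which integrates exactly because [Phi''] has a sign. *)
Lemma oscillation_first_derivative (Phi Phi1 Phi2 : R -> R) (nu p q : R) :
  (forall s, is_derive Phi s (Phi1 s)) -> (forall s, is_derive Phi1 s (Phi2 s)) ->
  (forall s, continuous Phi2 s) -> (forall s, 0 <= Phi2 s) ->
  0 < nu -> nu <= Phi1 p -> p <= q ->
  Cmod (intC (fun s => cis (Phi s)) p q) <= 2 / nu.
Proof.
  intros H1 H2 H3 Hpos Hnu Hp Hpq.
  assert (Hge : forall s, p <= s -> nu <= Phi1 s).
  { intros s Hs. generalize (mean_value_lower Phi1 Phi2 0 p s H2 Hpos Hs). lra. }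
  assert (C1 : forall s, continuous Phi s) by (intros s; apply (ex_derive_continuous (V := R_NormedModule)); eexists; apply H1).
  assert (C2 : forall s, continuous Phi1 s) by (intros s; apply (ex_derive_continuous (V := R_NormedModule)); eexists; apply H2).
  assert (Cc : forall s, contC (fun s : R => cis (Phi s)) s) by (intros s; apply continuous_cis, C1).
  set (D := fun s => (- Ci * cis (Phi s) * RtoC (/ Phi1 s))%C).
  set (r := fun s => (Ci * cis (Phi s) * RtoC (Phi2 s / Phi1 s ^ 2))%C).
  assert (HD : forall s, p <= s -> derivC D s (cis (Phi s) + r s)%C).
  { intros s Hs. assert (Hn : Phi1 s <> 0) by (specialize (Hge s Hs); lra).
    replace (cis (Phi s) + r s)%C
      with ((- Ci * (Ci * RtoC (Phi1 s) * cis (Phi s))) * RtoC (/ Phi1 s) + (- Ci * cis (Phi s)) * RtoC (- Phi2 s / Phi1 s ^ 2))%C.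
    - apply (is_derive_Cmult (fun s => - Ci * cis (Phi s))%C (fun s => RtoC (/ Phi1 s))).
      + apply (is_derive_Cscal (- Ci)%C (fun s => cis (Phi s))). apply is_derive_cis, H1.
      + apply (is_derive_RtoC (fun s => / Phi1 s)). apply (is_derive_inv Phi1 s (Phi2 s) (H2 s) Hn).
    - unfold r. apply injective_projections; simpl; field; exact Hn. }
  assert (Cinv : forall s, p <= s -> continuous (fun s => Phi2 s / Phi1 s ^ 2) s).
  { intros s Hs. apply (continuous_mult (K := R_AbsRing)); [apply H3|].
    apply continuous_Rinv_comp.
    - apply (continuous_mult (K := R_AbsRing)); [apply C2|].
      apply (continuous_mult (K := R_AbsRing)); [apply C2 | apply continuous_const].
    - apply pow_nonzero. specialize (Hge s Hs). lra. }
  assert (Cr : forall s, p <= s -> contC r s).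
  { intros s Hs. apply continuous_Cmult; [apply continuous_Cmult; [apply continuous_const | apply Cc]|].
    apply continuous_RtoC, Cinv, Hs. }
  assert (I1 : is_intC (fun s => cis (Phi s) + r s)%C p q (D q - D p)%C).
  { apply (is_RInt_derive (V := C_R_CompleteNormedModule) D).
    - intros x. rewrite Rmin_left by lra. intros Hx. apply HD; lra.
    - intros x. rewrite Rmin_left by lra. intros Hx.
      apply continuous_Cplus; [apply Cc | apply Cr; lra]. }
  assert (I2 : is_intC r p q ((D q - D p) - intC (fun s => cis (Phi s)) p q)%C).
  { apply (is_RInt_ext (V := C_R_NormedModule) (fun s => (cis (Phi s) + r s) - cis (Phi s))%C).
    - intros x _. simpl. ring.
    - apply (is_RInt_minus (V := C_R_NormedModule)); [exact I1 | apply ex_intC, Cc]. }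
  assert (I3 : is_RInt (fun s => Phi2 s / Phi1 s ^ 2) p q (/ Phi1 p - / Phi1 q)).
  { replace (/ Phi1 p - / Phi1 q) with (minus (- / Phi1 q) (- / Phi1 p))
      by (unfold minus, plus, opp; simpl; ring).
    apply (is_RInt_derive (V := R_CompleteNormedModule) (fun s => - / Phi1 s)).
    - intros x. rewrite Rmin_left by lra. intros Hx.
      replace (Phi2 x / Phi1 x ^ 2) with (opp (- Phi2 x / Phi1 x ^ 2)) by (unfold opp; simpl; field; specialize (Hge x); lra).
      apply (is_derive_opp (V := R_NormedModule) (fun s => / Phi1 s)).
      apply (is_derive_inv Phi1 x (Phi2 x) (H2 x)). specialize (Hge x). lra.
    - intros x. rewrite Rmin_left by lra. intros Hx. apply Cinv; lra. }
  assert (B : Cmod ((D q - D p) - intC (fun s => cis (Phi s)) p q)%C <= / Phi1 p - / Phi1 q).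
  { rewrite <- norm_C. apply (norm_RInt_le (V := C_R_NormedModule) r (fun s => Phi2 s / Phi1 s ^ 2) p q); try assumption.
    intros x Hx. rewrite norm_C. unfold r. rewrite !Cmod_mult, Cmod_cis, Cmod_Ci, Cmod_R.
    rewrite Rabs_pos_eq; [lra|]. apply Rdiv_le_0_compat; [apply Hpos|]. apply pow_lt. specialize (Hge x). lra. }
  assert (BD : forall s, p <= s -> Cmod (D s) = / Phi1 s).
  { intros s Hs. unfold D. rewrite !Cmod_mult, Cmod_cis, Cmod_opp, Cmod_Ci, Cmod_R.
    rewrite Rabs_pos_eq; [ring|]. left. apply Rinv_0_lt_compat. specialize (Hge s Hs). lra. }
  (* The boundary terms give [1 / Phi'(p) + 1 / Phi'(q)] and the error [1 / Phi'(p) - 1 / Phi'(q)];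
     the sum is [2 / Phi'(p)]. *)
  replace (intC (fun s => cis (Phi s)) p q)
    with ((D q + - D p) + - ((D q - D p) - intC (fun s => cis (Phi s)) p q))%C by ring.
  eapply Rle_trans; [apply Cmod_triangle|].
  eapply Rle_trans; [apply Rplus_le_compat_r, Cmod_triangle|].
  rewrite !Cmod_opp, !BD by lra.
  assert (/ Phi1 p <= / nu) by (apply Rinv_le_contravar; lra).
  unfold Rdiv. lra.
Qed.

(** Split at distance [1 / sqrt lam] from the critical point. The near piece is bounded by its
    length; beyond it [Phi'] is at least [lam / sqrt lam = sqrt lam], and the first derivative test
    gives [2 / sqrt lam]. *)
Lemma van_der_Corput_right (Phi Phi1 Phi2 : R -> R) (lam c q : R) :
  (forall s, is_derive Phi s (Phi1 s)) -> (forall s, is_derive Phi1 s (Phi2 s)) ->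
  (forall s, continuous Phi2 s) -> 0 < lam -> (forall s, lam <= Phi2 s) ->
  Phi1 c = 0 -> c <= q ->
  Cmod (intC (fun s => cis (Phi s)) c q) <= 3 / sqrt lam.
Proof.
  intros H1 H2 H3 Hlam Hge Hc Hq.
  assert (Hs := sqrt_lt_R0 lam Hlam).
  assert (Hi := Rinv_0_lt_compat _ Hs).
  assert (Cc : forall s, contC (fun s : R => cis (Phi s)) s).
  { intros s; apply continuous_cis, (ex_derive_continuous (V := R_NormedModule)); eexists; apply H1. }
  assert (short : forall p, c <= p <= c + / sqrt lam -> Cmod (intC (fun s => cis (Phi s)) c p) <= / sqrt lam).
  { intros p Hp. apply Rle_trans with ((p - c) * 1); [|lra].
    apply Cmod_intC_le_const; [lra | exact Cc |]. intros x _. rewrite Cmod_cis. lra. }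
  destruct (Rle_lt_dec q (c + / sqrt lam)) as [Hle|Hlt].
  - eapply Rle_trans; [apply short; lra|]. unfold Rdiv. lra.
  - rewrite <- (intC_Chasles _ c (c + / sqrt lam) q Cc).
    eapply Rle_trans; [apply Cmod_triangle|].
    assert (S := short (c + / sqrt lam) ltac:(lra)).
    assert (L : Cmod (intC (fun s => cis (Phi s)) (c + / sqrt lam) q) <= 2 / sqrt lam).
    { apply (oscillation_first_derivative Phi Phi1 Phi2); try assumption; try lra.
      - intros s. specialize (Hge s). lra.
      - generalize (mean_value_lower Phi1 Phi2 lam c (c + / sqrt lam) H2 Hge ltac:(lra)).
        rewrite Hc. replace (lam * (c + / sqrt lam - c)) with (sqrt lam); [lra|].
        rewrite <- (sqrt_sqrt lam) at 2 by lra. field. lra. }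
    unfold Rdiv in *. lra.
Qed.

Lemma intC_comp_opp (f : R -> C) (a b : R) :
  (forall x, contC f x) -> intC f a b = (- intC (fun s => f (- s)%R) (- a)%R (- b)%R)%C.
Proof.
  intros Hf.
  assert (E : is_intC (fun y => - f (- y)%R)%C (- a) (- b) (intC f a b)).
  { apply (is_RInt_comp_opp (V := C_R_NormedModule) f). rewrite !Ropp_involutive. apply ex_intC, Hf. }
  assert (Cf : forall x, contC (fun s : R => f (- s)) x).
  { intros x. apply (continuous_comp Ropp f); [apply (continuous_opp (V := R_NormedModule)), continuous_id | apply Hf]. }
  rewrite <- (intC_unique _ _ _ _ E). apply intC_unique.
  apply (is_RInt_opp (V := C_R_NormedModule)). apply ex_intC, Cf.
Qed.

Lemma Ropp_is_derive (f df : R -> R) :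
  (forall s, is_derive f s (df s)) -> forall s, is_derive (fun s => f (- s)) s (- df (- s)).
Proof.
  intros H s. replace (- df (- s)) with (scal (-1) (df (- s))) by (unfold scal; simpl; unfold mult; simpl; ring).
  apply (is_derive_comp (V := R_NormedModule) f Ropp); [apply H|].
  auto_derive; [exact I | ring].
Qed.

Lemma van_der_Corput_pos (Phi Phi1 Phi2 : R -> R) (lam : R) :
  (forall s, is_derive Phi s (Phi1 s)) -> (forall s, is_derive Phi1 s (Phi2 s)) ->
  (forall s, continuous Phi2 s) -> 0 < lam -> (forall s, lam <= Phi2 s) ->
  exists E : R -> C, (forall s, derivC E s (cis (Phi s))) /\ forall s, Cmod (E s) <= 3 / sqrt lam.
Proof.
  intros H1 H2 H3 Hlam Hge.
  assert (Cc : forall s, contC (fun s : R => cis (Phi s)) s).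
  { intros s; apply continuous_cis, (ex_derive_continuous (V := R_NormedModule)); eexists; apply H1. }
  (* [Phi'] grows at rate at least [lam], so it changes sign within distance [|Phi'(0)| / lam] of
     the origin. *)
  assert (Hc : exists c, Phi1 c = 0).
  { set (d := Rabs (Phi1 0) / lam).
    assert (Hd : 0 <= d) by (apply Rdiv_le_0_compat; [apply Rabs_pos | exact Hlam]).
    assert (Hld : lam * d = Rabs (Phi1 0)) by (unfold d; field; lra).
    assert (A := mean_value_lower Phi1 Phi2 lam 0 d H2 Hge Hd).
    assert (B := mean_value_lower Phi1 Phi2 lam (- d) 0 H2 Hge ltac:(lra)).
    assert (Hab := Rle_abs (Phi1 0)). assert (Hab' := Rle_abs (- Phi1 0)). rewrite Rabs_Ropp in Hab'.
    replace (lam * (d - 0)) with (lam * d) in A by ring.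
    replace (lam * (0 - - d)) with (lam * d) in B by ring.
    destruct (IVT_gen Phi1 (- d) d 0) as [c [_ Hc]].
    - intros x. apply continuity_pt_filterlim. apply (ex_derive_continuous (V := R_NormedModule)). eexists; apply H2.
    - rewrite Rmin_left, Rmax_right by lra. lra.
    - exists c. exact Hc. }
  destruct Hc as [c Hc].
  exists (fun s => intC (fun s => cis (Phi s)) c s). split.
  - intros s. apply (is_derive_intC (fun s => cis (Phi s))), Cc.
  - intros s. destruct (Rle_lt_dec c s) as [Hs|Hs].
    + apply (van_der_Corput_right Phi Phi1 Phi2); assumption.
    (* To the left of the critical point, the reflection [s -> - s] preserves the sign of the second
       derivative and leads back to the right half-line. *)
    + rewrite intC_comp_opp by exact Cc. rewrite Cmod_opp.
      apply (van_der_Corput_right (fun s => Phi (- s)) (fun s => - Phi1 (- s)) (fun s => Phi2 (- s))); try lra.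
      * apply Ropp_is_derive, H1.
      * intros x. replace (Phi2 (- x)) with (opp (- Phi2 (- x))) by (unfold opp; simpl; ring).
        apply (is_derive_opp (V := R_NormedModule) (fun s => Phi1 (- s))). apply Ropp_is_derive, H2.
      * intros x. apply (continuous_comp Ropp Phi2); [apply (continuous_opp (V := R_NormedModule)), continuous_id | apply H3].
      * intros x. apply Hge.
      * rewrite Ropp_involutive. lra.
Qed.

Lemma constant_sign (f : R -> R) (lam : R) :
  (forall s, continuous f s) -> 0 < lam -> (forall s, lam <= Rabs (f s)) ->
  (forall s, lam <= f s) \/ (forall s, lam <= - f s).
Proof.
  intros Hf Hlam Habs.
  destruct (Rle_lt_dec 0 (f 0)) as [H0|H0]; [left|right]; intros s; specialize (Habs s) as Hs.
  - destruct (Rle_lt_dec 0 (f s)) as [Hp|Hn]; [rewrite Rabs_pos_eq in Hs; lra|].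
    destruct (IVT_gen f s 0 0) as [z [_ Hz]].
    + intros x. apply continuity_pt_filterlim, Hf.
    + rewrite Rmin_left, Rmax_right; lra.
    + specialize (Habs z). rewrite Hz, Rabs_R0 in Habs. lra.
  - destruct (Rle_lt_dec 0 (f s)) as [Hp|Hn]; [|rewrite Rabs_left in Hs; lra].
    destruct (IVT_gen f 0 s 0) as [z [_ Hz]].
    + intros x. apply continuity_pt_filterlim, Hf.
    + rewrite Rmin_left, Rmax_right; lra.
    + specialize (Habs z). rewrite Hz, Rabs_R0 in Habs. lra.
Qed.

(* The primitive starts at the critical point of [Phi], so that only the monotone half-lines have to be
   estimated. *)
Lemma van_der_Corput (Phi Phi1 Phi2 : R -> R) (lam : R) :
  (forall s, is_derive Phi s (Phi1 s)) -> (forall s, is_derive Phi1 s (Phi2 s)) ->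
  (forall s, continuous Phi2 s) -> 0 < lam -> (forall s, lam <= Rabs (Phi2 s)) ->
  exists E : R -> C, (forall s, derivC E s (cis (Phi s))) /\ forall s, Cmod (E s) <= 3 / sqrt lam.
Proof.
  intros H1 H2 H3 Hlam Habs.
  destruct (constant_sign Phi2 lam H3 Hlam Habs) as [Hp|Hn].
  - apply (van_der_Corput_pos Phi Phi1 Phi2); assumption.
  - destruct (van_der_Corput_pos (fun s => - Phi s) (fun s => - Phi1 s) (fun s => - Phi2 s) lam) as [E [HE HB]]; try assumption.
    + intros s. apply (is_derive_opp (V := R_NormedModule)), H1.
    + intros s. apply (is_derive_opp (V := R_NormedModule)), H2.
    + intros s. apply (continuous_opp (V := R_NormedModule)), H3.
    (* Conjugation turns a primitive of [e^(- i Phi)] into one of [e^(i Phi)] without changing its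
       modulus. *)
    + exists (fun s => Cconj (E s)). split.
      * intros s. replace (cis (Phi s)) with ((Re (cis (- Phi s)), - Im (cis (- Phi s))) : C).
        -- apply (is_derive_C_pair (fun s => Re (E s)) (fun s => - Im (E s))).
           ++ apply (is_derive_Re _ _ _ (HE s)).
           ++ apply (is_derive_opp (V := R_NormedModule) (fun s => Im (E s))). apply (is_derive_Im _ _ _ (HE s)).
        -- unfold cis. rewrite cos_neg, sin_neg. apply injective_projections; simpl; ring.
      * intros s. replace (Cmod (Cconj (E s))) with (Cmod (E s)); [apply HB|].
        unfold Cmod, Cconj; simpl. f_equal. ring.
Qed.

(** One integration by parts in [y], then one in [x], moves both derivatives onto [M]. The constant
    is the integral of the modulus of the mixed derivative and is chosen before the exponentials,
    hence independent of [t] and [x]. Vanishing on the closed set [K <= Rabs x] or [K <= Rabs y]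
    kills the boundary terms at the endpoints themselves. *)
Lemma double_oscillation_bound (M : R -> R -> C) (K : R) :
  Ck 2 M -> 0 < K -> (forall x y, K <= Rabs x \/ K <= Rabs y -> M x y = 0%C) ->
  exists S : R, forall (E1 E2 e1 e2 : R -> C) (B1 B2 : R),
    (forall s, derivC E1 s (e1 s)) -> (forall s, derivC E2 s (e2 s)) ->
    (forall s, contC e1 s) -> (forall s, contC e2 s) ->
    (forall s, Cmod (E1 s) <= B1) -> (forall s, Cmod (E2 s) <= B2) ->
    Cmod (intC (fun x => intC (fun y => e1 x * e2 y * M x y)%C (- K) K) (- K) K) <= S * B1 * B2.
Proof.
  intros [CM [Mx [My [M1 [M2 [M3 M4]]]]]] HK Hs.
  destruct M4 as [CMy [Myx [Myy [N1 [N2 [N3 N4]]]]]]. simpl in N3.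
  set (A := fun x => intC (fun y => RtoC (Cmod (Myx x y))) (- K) K).
  assert (CA2 : contC2 (fun x y => RtoC (Cmod (Myx x y)))).
  { intros p. apply continuous_RtoC, continuous_Cmod, N3. }
  assert (CA : forall x, contC A x) by (intros x; apply continuous_intC_param, CA2).
  exists (Re (intC A (- K) K)).
  intros E1 E2 e1 e2 B1 B2 D1 D2 C1 C2 HB1 HB2.
  assert (Hb : Rabs K = K /\ Rabs (- K) = K) by (rewrite Rabs_Ropp, Rabs_pos_eq; lra).
  assert (CE1 : forall s, contC E1 s) by (intros s; eapply is_derive_continuousC, D1).
  assert (CE2 : forall s, contC E2 s) by (intros s; eapply is_derive_continuousC, D2).
  assert (HB1' : 0 <= B1) by (eapply Rle_trans; [apply Cmod_ge_0 | apply (HB1 0)]).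
  assert (HB2' : 0 <= B2) by (eapply Rle_trans; [apply Cmod_ge_0 | apply (HB2 0)]).
  set (J := fun x => intC (fun y => E2 y * My x y)%C (- K) K).
  set (J1 := fun x => intC (fun y => E2 y * Myx x y)%C (- K) K).
  assert (CE2M : forall h, contC2 h -> contC2 (fun x y : R => E2 y * h x y)%C).
  { intros h Hh [x y]. apply continuous_Cmult; [|apply Hh].
    apply (continuous_comp snd E2); [apply continuous_snd | apply CE2]. }
  assert (DJ : forall x, derivC J x (J1 x)).
  { intros x. apply (is_derive_intC_param (fun x y => E2 y * My x y)%C (fun x y => E2 y * Myx x y)%C).
    - intros x' y. apply (is_derive_Cscal (E2 y) (fun x => My x y)), N1.
    - intros x' y. apply (contC2_r (fun x y => E2 y * My x y)%C), CE2M, CMy.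
    - apply CE2M, N3. }
  assert (CJ1 : forall x, contC J1 x) by (intros x; apply continuous_intC_param, CE2M, N3).
  assert (inner : forall x, intC (fun y => e1 x * e2 y * M x y)%C (- K) K = (- (e1 x * J x))%C).
  { intros x. rewrite (intC_ext _ (fun y => e1 x * (e2 y * M x y))%C) by (intros; ring).
    rewrite intC_scal.
    - rewrite (intC_by_parts E2 (M x) e2 (My x)); auto.
      + rewrite (Hs x K), (Hs x (- K)) by (right; lra). unfold J. ring.
      + intros y. apply contC2_r, CMy.
    - intros y. apply continuous_Cmult; [apply C2 | apply contC2_r, CM]. }
  (* For such [x] the whole slice [M x] is zero, hence also its derivative in [y]; no neighbourhood
     in [x] is involved, so the endpoints are included. *)
  assert (MyK : forall x y, K <= Rabs x -> My x y = 0%C).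
  { intros x y Hx. apply (is_derive_C_unique (M x) y); [apply M2|].
    apply (is_derive_ext (V := C_R_NormedModule) (fun _ => RtoC 0)).
    - intros t. symmetry. apply Hs. left; exact Hx.
    - apply (is_derive_const (V := C_R_NormedModule)). }
  assert (JK : forall x, K <= Rabs x -> J x = 0%C).
  { intros x Hx. unfold J. rewrite (intC_ext _ (fun _ => RtoC 0)); [apply intC_zero|].
    intros y _. rewrite MyK by exact Hx. ring. }
  rewrite (intC_ext _ (fun x => - (1) * (e1 x * J x))%C) by (intros; rewrite inner; ring).
  assert (CJ : forall x, contC J x) by (intros x; eapply is_derive_continuousC, DJ).
  rewrite intC_scal by (intros x; apply continuous_Cmult; auto).
  rewrite (intC_by_parts E1 J e1 J1) by auto.
  rewrite (JK K), (JK (- K)) by lra.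
  replace (- (1) * (E1 K * 0 - E1 (- K)%R * 0 - intC (fun x => E1 x * J1 x) (- K)%R K))%C
    with (intC (fun x => E1 x * J1 x)%C (- K) K) by ring.
  apply (Cmod_intC_le _ (fun x => B1 * (B2 * Re (A x)))); [lra | | |].
  - intros x. apply continuous_Cmult; auto.
  - intros x _. rewrite Cmod_mult. apply Rmult_le_compat; try apply Cmod_ge_0; [apply HB1|].
    apply (Cmod_intC_le _ (fun y => B2 * Cmod (Myx x y))); [lra | | |].
    + intros y. apply (contC2_r (fun x y => E2 y * Myx x y)%C), CE2M, N3.
    + intros y _. rewrite Cmod_mult. apply Rmult_le_compat_r; [apply Cmod_ge_0 | apply HB2].
    + apply (is_RInt_scal (V := R_NormedModule)).
      apply (Re_intC (fun y => RtoC (Cmod (Myx x y)))). intros y. apply (contC2_r (fun x y => RtoC (Cmod (Myx x y)))), CA2.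
  - replace (Re (intC A (- K) K) * B1 * B2) with (scal B1 (scal B2 (Re (intC A (- K) K))))
      by (unfold scal; simpl; unfold mult; simpl; ring).
    apply (is_RInt_scal (V := R_NormedModule)). apply (is_RInt_scal (V := R_NormedModule)).
    apply Re_intC, CA.
Qed.

(** * The Dirichlet kernel *)

Lemma continuous_Rmult {T : UniformSpace} (u v : T -> R) (x : T) :
  continuous u x -> continuous v x -> continuous (fun t => u t * v t) x.
Proof. apply (continuous_mult (K := R_AbsRing)). Qed.

Lemma continuous_Rplus {T : UniformSpace} (u v : T -> R) (x : T) :
  continuous u x -> continuous v x -> continuous (fun t => u t + v t) x.
Proof. apply (continuous_plus (V := R_NormedModule)). Qed.

Lemma continuous_Ropp {T : UniformSpace} (u : T -> R) (x : T) :
  continuous u x -> continuous (fun t => - u t) x.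
Proof. apply (continuous_opp (V := R_NormedModule)). Qed.

Lemma continuous_sin_comp {T : UniformSpace} (u : T -> R) (x : T) :
  continuous u x -> continuous (fun t => sin (u t)) x.
Proof. intros H. apply (continuous_comp u sin); [exact H | apply continuous_sin]. Qed.

Lemma continuous_cos_comp {T : UniformSpace} (u : T -> R) (x : T) :
  continuous u x -> continuous (fun t => cos (u t)) x.
Proof. intros H. apply (continuous_comp u cos); [exact H | apply continuous_cos]. Qed.

Lemma continuous_exp_comp {T : UniformSpace} (u : T -> R) (x : T) :
  continuous u x -> continuous (fun t => exp (u t)) x.
Proof.
  intros H. apply (continuous_comp u exp); [exact H|].
  apply (ex_derive_continuous (V := R_NormedModule)). eexists. apply is_derive_exp.
Qed.

Lemma continuous_fst_pt {S T : UniformSpace} (p : S * T) : continuous (fun q : S * T => fst q) p.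
Proof. destruct p. apply continuous_fst. Qed.

Lemma continuous_snd_pt {S T : UniformSpace} (p : S * T) : continuous (fun q : S * T => snd q) p.
Proof. destruct p. apply continuous_snd. Qed.

Ltac prove_continuous :=
  cbv beta; lazymatch goal with
  | |- continuous (fun _ => _ * _) _ => apply continuous_Rmult; prove_continuous
  | |- continuous (fun _ => _ + _) _ => apply continuous_Rplus; prove_continuous
  | |- continuous (fun _ => - _) _ => apply continuous_Ropp; prove_continuous
  | |- continuous (fun _ => sin _) _ => apply continuous_sin_comp; prove_continuous
  | |- continuous (fun _ => cos _) _ => apply continuous_cos_comp; prove_continuous
  | |- continuous (fun _ => exp _) _ => apply continuous_exp_comp; prove_continuous
  | |- continuous (Rmult ?k) _ => apply (continuous_Rmult (fun _ => k) (fun y => y)); prove_continuous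
  | |- continuous sin _ => apply continuous_sin
  | |- continuous cos _ => apply continuous_cos
  | |- continuous fst _ => apply continuous_fst_pt
  | |- continuous snd _ => apply continuous_snd_pt
  | |- continuous (fun q => fst q) _ => apply continuous_fst_pt
  | |- continuous (fun q => snd q) _ => apply continuous_snd_pt
  | |- continuous (fun q => q) _ => apply continuous_id
  | |- continuous (fun _ => ?c) _ => apply continuous_const
  end.

(* The real part of the integral of [exp (i z) / (i z)] over the quarter circle of radius [T]; hence
   [dirichlet T = PI / 2 - (integral of sin x / x over (0, T))]. *)
Definition dirichlet (T : R) : R :=
  RInt (fun th => exp (- (T * sin th)) * cos (T * cos th)) 0 (PI / 2).

Definition dirichlet' (T : R) : R :=
  RInt (fun th => - ((sin th * cos (T * cos th) + cos th * sin (T * cos th)) * exp (- (T * sin th)))) 0 (PI / 2).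

Lemma is_RInt_RInt_continuous (f : R -> R) (a b : R) : (forall x, continuous f x) -> is_RInt f a b (RInt f a b).
Proof.
  intros H. apply (RInt_correct (V := R_CompleteNormedModule)).
  apply (ex_RInt_continuous (V := R_CompleteNormedModule)). intros; apply H.
Qed.

Lemma is_derive_dirichlet (T : R) : is_derive dirichlet T (dirichlet' T).
Proof.
  apply (is_derive_RInt_param_cont (fun T th => exp (- (T * sin th)) * cos (T * cos th))
    (fun T th => - ((sin th * cos (T * cos th) + cos th * sin (T * cos th)) * exp (- (T * sin th))))).
  - intros x y. auto_derive; [exact I | ring].
  - intros x y. prove_continuous.
  - intros p. prove_continuous.
  - apply is_RInt_RInt_continuous. intros x. prove_continuous.
Qed.

(** After multiplication by [T] the integrand is the exact [th]-derivative of
    [exp (- (T * sin th)) * sin (T * cos th)]. The product form stays valid at [T = 0]. *)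
Lemma dirichlet'_sin (T : R) : T * dirichlet' T = - sin T.
Proof.
  unfold dirichlet'.
  set (h := fun th => - ((sin th * cos (T * cos th) + cos th * sin (T * cos th)) * exp (- (T * sin th)))).
  assert (A : is_RInt (fun th => T * h th) 0 (PI / 2) (T * RInt h 0 (PI / 2))).
  { apply (is_RInt_scal (V := R_NormedModule)). apply is_RInt_RInt_continuous. intros x. unfold h. prove_continuous. }
  assert (B : is_RInt (fun th => T * h th) 0 (PI / 2)
    (exp (- (T * sin (PI / 2))) * sin (T * cos (PI / 2)) - exp (- (T * sin 0)) * sin (T * cos 0))).
  { apply (is_RInt_derive (V := R_CompleteNormedModule) (fun th => exp (- (T * sin th)) * sin (T * cos th))).
    - intros x _. unfold h. auto_derive; [exact I | ring].
    - intros x _. unfold h. prove_continuous. }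
  rewrite <- (is_RInt_unique _ _ _ _ A), (is_RInt_unique _ _ _ _ B).
  rewrite cos_PI2, sin_0, cos_0, Rmult_0_r, Rmult_1_r, Ropp_0, exp_0, sin_0. ring.
Qed.

Lemma dirichlet_0 : dirichlet 0 = PI / 2.
Proof.
  unfold dirichlet. rewrite (RInt_ext _ (fun _ => 1)).
  - rewrite RInt_const. unfold scal; simpl; unfold mult; simpl. ring.
  - intros x _. rewrite !Rmult_0_l, Ropp_0, exp_0, cos_0. apply Rmult_1_l.
Qed.

Lemma dirichlet'_0 : dirichlet' 0 = -1.
Proof.
  unfold dirichlet'. apply is_RInt_unique.
  apply (is_RInt_ext (V := R_NormedModule) (fun th => - sin th)).
  - intros x _. rewrite !Rmult_0_l, Ropp_0, exp_0, cos_0, sin_0.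
    lazymatch goal with |- ?l = ?r => change (@eq R l r) end. ring.
  - replace (-1) with (minus (cos (PI / 2)) (cos 0)).
    + apply (is_RInt_derive (V := R_CompleteNormedModule) cos).
      * intros x _. apply is_derive_cos.
      * intros x _. prove_continuous.
    + rewrite cos_PI2, cos_0. unfold minus, plus, opp; simpl. ring.
Qed.

(** A crude form of Jordan's inequality, sufficient for exponential decay along the arc; it follows
    from the Taylor polynomial of degree 7 and [PI <= 4]. *)
Lemma sin_ge_quarter (x : R) : 0 <= x <= PI / 2 -> x / 4 <= sin x.
Proof.
  intros Hx. assert (Hpi := PI_4). assert (Hpi0 := PI_RGT_0).
  destruct (SIN x) as [H _]; [lra | lra |].
  eapply Rle_trans; [|exact H].
  unfold sin_lb, sin_approx, sin_term. cbn [sum_f_R0 Nat.mul Nat.add pow].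
  replace (INR (Factorial.fact 1)) with 1 by (simpl; ring).
  replace (INR (Factorial.fact 3)) with 6 by (simpl; ring).
  replace (INR (Factorial.fact 5)) with 120 by (simpl; ring).
  replace (INR (Factorial.fact 7)) with 5040 by (rewrite INR_IZR_INZ; reflexivity).
  assert (0 <= x <= 2) by lra.
  assert (Hx2 : 0 <= x * x <= 4) by nra.
  (* The Taylor polynomial minus [x / 4]. As [x * x <= 4], the first two terms in the bracket leave
     at least [1 / 12] and the last product is nonnegative. *)
  assert (Hp : x * (3 / 4 - (x * x) / 6 + (x * x) * (x * x) * (1 / 120 - (x * x) / 5040)) >= 0).
  { assert (0 <= (x * x) * (x * x) * (1 / 120 - (x * x) / 5040)) by (apply Rmult_le_pos; nra). nra. }
  lazymatch goal with |- _ <= ?e => replace e with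
    (x / 4 + x * (3 / 4 - (x * x) / 6 + (x * x) * (x * x) * (1 / 120 - (x * x) / 5040))) by field end.
  lra.
Qed.

(** Here [6 = 2 + 4]: the arc parameter has length at most 2, and the majorant [exp (- T th / 4)]
    has integral at most [4 / T]. *)
Lemma dirichlet_bound (T : R) : 0 <= T -> (1 + T) * Rabs (dirichlet T) <= 6.
Proof.
  intros HT. assert (Hpi := PI_4). assert (Hpi0 := PI_RGT_0).
  assert (I0 : is_RInt (fun th => exp (- (T * sin th)) * cos (T * cos th)) 0 (PI / 2) (dirichlet T)).
  { apply is_RInt_RInt_continuous. intros x. prove_continuous. }
  assert (Hle : forall th, 0 <= th <= PI / 2 -> Rabs (exp (- (T * sin th)) * cos (T * cos th)) <= exp (- (T * (th * / 4)))).
  { intros th Hth. rewrite Rabs_mult, (Rabs_pos_eq (exp _)) by (left; apply exp_pos).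
    apply Rle_trans with (exp (- (T * sin th)) * 1).
    - apply Rmult_le_compat_l; [left; apply exp_pos|]. apply Rabs_le, COS_bound.
    - rewrite Rmult_1_r. assert (H := sin_ge_quarter th Hth).
      destruct (Req_dec (- (T * sin th)) (- (T * (th * / 4)))) as [-> |Hne]; [lra|].
      left. apply exp_increasing. assert (T * (th * / 4) <= T * sin th) by (apply Rmult_le_compat_l; lra). lra. }
  assert (B1 : Rabs (dirichlet T) <= 2).
  { apply Rle_trans with (scal (PI / 2 - 0) 1); [|unfold scal; simpl; unfold mult; simpl; lra].
    apply (norm_RInt_le (V := R_NormedModule) (fun th => exp (- (T * sin th)) * cos (T * cos th)) (fun _ => 1) 0 (PI / 2)); try lra.
    - intros th Hth. eapply Rle_trans; [apply Hle, Hth|].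
      rewrite <- exp_0. destruct (Req_dec (- (T * (th * / 4))) 0) as [-> |Hne]; [lra|].
      left. apply exp_increasing. nra.
    - exact I0.
    - apply (is_RInt_const (V := R_NormedModule)). }
  destruct HT as [HT|HT]; [|subst; lra].
  assert (B2 : Rabs (dirichlet T) <= 4 / T).
  { apply Rle_trans with (minus (- (4 / T) * exp (- (T * (PI / 2 * / 4)))) (- (4 / T) * exp (- (T * (0 * / 4))))).
    - apply (norm_RInt_le (V := R_NormedModule) (fun th => exp (- (T * sin th)) * cos (T * cos th)) (fun th => exp (- (T * (th * / 4)))) 0 (PI / 2)); try lra.
      + exact Hle.
      + exact I0.
      + apply (is_RInt_derive (V := R_CompleteNormedModule) (fun th => - (4 / T) * exp (- (T * (th * / 4))))).
        * intros x _. auto_derive; [exact I | field; lra].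
        * intros x _. unfold Rdiv. prove_continuous.
    - replace (- (T * (0 * / 4))) with 0 by ring. rewrite exp_0. unfold minus, plus, opp; simpl.
      assert (0 < 4 / T) by (apply Rdiv_lt_0_compat; lra).
      generalize (exp_pos (- (T * (PI / 2 * / 4)))). intros. nra. }
  assert (T * Rabs (dirichlet T) <= 4).
  { replace 4 with (T * (4 / T)) by (field; lra). apply Rmult_le_compat_l; lra. }
  lra.
Qed.

Lemma Cmult_reg_l (k p q : C) : k <> 0%C -> (k * p)%C = (k * q)%C -> p = q.
Proof.
  intros Hk E. replace p with (/ k * (k * p))%C by (field; exact Hk).
  rewrite E. field; exact Hk.
Qed.

Definition dirichlet_kernel (B u : R) : C := intC (fun x => cis (x * u)) (- B) B.

(** The kernel [2 sin (B u) / u] in a division-free form, in which [dirichlet'] already carries the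
    value at the removable singularity. *)
Lemma dirichlet_kernel_eq (B u : R) : dirichlet_kernel B u = RtoC (- 2 * B * dirichlet' (B * u)).
Proof.
  assert (Cc : forall x, contC (fun x : R => cis (x * u)) x).
  { intros x. apply continuous_cis. prove_continuous. }
  destruct (Req_dec u 0) as [-> |Hu].
  - unfold dirichlet_kernel. rewrite Rmult_0_r, dirichlet'_0.
    rewrite (intC_ext _ (fun _ => RtoC 1)) by (intros; rewrite Rmult_0_r; apply cis_0).
    rewrite (intC_derive (fun x => RtoC x) (fun _ => RtoC 1)).
    + rewrite <- RtoC_minus. f_equal. ring.
    + intros x. apply is_derive_RtoC. apply (is_derive_id (K := R_AbsRing)).
    + intros x. apply continuous_const.
  (* Multiplied by [i u], both sides become [e^(iBu) - e^(-iBu)]. *)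
  - assert (E : (Ci * RtoC u * dirichlet_kernel B u)%C = (cis (B * u) - cis (- B * u)%R)%C).
    { unfold dirichlet_kernel. rewrite <- intC_scal by exact Cc.
      apply (intC_derive (fun x => cis (x * u))).
      - intros x. apply (is_derive_cis (fun x => x * u)). auto_derive; [exact I | ring].
      - intros x. apply continuous_Cmult; [apply continuous_const | apply Cc]. }
    assert (E2 : (Ci * RtoC u * RtoC (- 2 * B * dirichlet' (B * u)))%C = (cis (B * u) - cis (- B * u)%R)%C).
    { assert (S := dirichlet'_sin (B * u)).
      replace (- B * u) with (- (B * u)) by ring.
      unfold cis. rewrite cos_neg, sin_neg.
      replace (sin (B * u)) with (- (B * u * dirichlet' (B * u))) by lra.
      apply injective_projections; simpl; ring. }
    rewrite <- E2 in E.
    assert (Hn : (Ci * RtoC u)%C <> 0%C).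
    { intros H0. apply Hu. apply (f_equal Im) in H0. simpl in H0. lra. }
    exact (Cmult_reg_l _ _ _ Hn E).
Qed.

Lemma continuous_dirichlet_kernel (B u : R) : contC (dirichlet_kernel B) u.
Proof.
  apply (continuous_intC_param (fun u x => cis (x * u))). intros p. apply continuous_cis. prove_continuous.
Qed.

(** This primitive equals [- PI] at [u = 0] and, for positive [B], tends to zero as [u] grows, so it
    shows the mass [PI] of the right half of the kernel. *)
Lemma is_derive_dirichlet_kernel (B u : R) :
  derivC (fun u => RtoC (- 2 * dirichlet (B * u))) u (dirichlet_kernel B u).
Proof.
  rewrite dirichlet_kernel_eq. apply is_derive_RtoC.
  replace (- 2 * B * dirichlet' (B * u)) with (- 2 * (B * dirichlet' (B * u))) by ring.
  apply (is_derive_scal (fun u => dirichlet (B * u)) u (- 2) (B * dirichlet' (B * u))).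
  apply (is_derive_comp (V := R_NormedModule) dirichlet (fun u => B * u)); [apply is_derive_dirichlet|].
  auto_derive; [exact I | ring].
Qed.

Lemma dirichlet_kernel_even (B u : R) : dirichlet_kernel B (- u) = dirichlet_kernel B u.
Proof.
  unfold dirichlet_kernel.
  assert (Cc : forall v x, contC (fun x : R => cis (x * v)) x).
  { intros v x. apply continuous_cis. prove_continuous. }
  rewrite (intC_comp_opp (fun x => cis (x * u))) by apply Cc. rewrite Ropp_involutive.
  rewrite (intC_ext (fun s => cis (- s * u)) (fun s => cis (s * - u))) by (intros; f_equal; ring).
  generalize (intC_Chasles (fun x => cis (x * - u)) (- B) B (- B) (Cc _)). rewrite intC_point. intros E.
  replace (intC (fun x => cis (x * - u)) (- B) B)
    with ((intC (fun x => cis (x * - u)) (- B) B + intC (fun x => cis (x * - u)) B (- B)%R)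
          - intC (fun x => cis (x * - u)) B (- B)%R)%C by ring.
  rewrite E. ring.
Qed.

(** Integrate by parts against the primitive [- 2 dirichlet (B u)]: the boundary term at [W]
    vanishes with [g], the one at 0 is [PI * g 0], and the rest is governed by the decay of
    [dirichlet]. *)
Lemma dirichlet_half (g dg : R -> C) (W S B : R) :
  (forall x, derivC g x (dg x)) -> (forall x, contC dg x) ->
  0 < W -> g W = 0%C -> (forall x, 0 <= x <= W -> Cmod (dg x) <= S) -> 0 < B ->
  Cmod (intC (fun u => dirichlet_kernel B u * g u)%C 0 W - RtoC PI * g 0)%C
    <= 24 * S / B * sqrt (1 + B * W).
Proof.
  intros Hg Cdg HW HgW HS HB.
  assert (HS0 : 0 <= S) by (eapply Rle_trans; [apply Cmod_ge_0 | apply (HS 0); lra]).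
  rewrite (intC_by_parts (fun u => RtoC (- 2 * dirichlet (B * u))) g (dirichlet_kernel B) dg).
  2: apply is_derive_dirichlet_kernel.
  2: exact Hg.
  2: apply continuous_dirichlet_kernel.
  2: exact Cdg.
  rewrite HgW, Rmult_0_r, dirichlet_0.
  replace (_ - _)%C with (- intC (fun x => RtoC (- 2 * dirichlet (B * x)) * dg x)%C 0 W)%C.
  2: { replace (- 2 * (PI / 2)) with (- PI) by field. rewrite RtoC_opp. ring. }
  rewrite Cmod_opp.
  assert (Hpos : forall x, 0 <= x -> 0 < 1 + B * x) by (intros; nra).
  apply Rle_trans with (minus (24 * S / B * sqrt (1 + B * W)) (24 * S / B * sqrt (1 + B * 0))).
  - apply (Cmod_intC_le _ (fun x => 12 * S / sqrt (1 + B * x))); [lra | | |].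
    + intros x. apply continuous_Cmult; [|apply Cdg].
      eapply is_derive_continuousC, is_derive_dirichlet_kernel.
    + intros x Hx. rewrite Cmod_mult, Cmod_R, Rabs_mult, (Rabs_left (-2)) by lra.
      assert (H1 := Hpos x (proj1 Hx)). assert (D := dirichlet_bound (B * x) ltac:(nra)).
      assert (Hs := sqrt_lt_R0 _ H1).
      (* The decay [1 / (1 + B x)] is weakened to the inverse square root, whose primitive is a
         square root instead of a logarithm; the resulting bound still tends to zero as [B]
         grows. *)
      assert (Hsq : sqrt (1 + B * x) <= 1 + B * x).
      { rewrite <- (sqrt_sqrt (1 + B * x)) at 2 by lra.
        assert (1 <= sqrt (1 + B * x)) by (rewrite <- sqrt_1 at 1; apply sqrt_le_1_alt; nra). nra. }
      assert (D2 : Rabs (dirichlet (B * x)) <= 6 / sqrt (1 + B * x)).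
      { apply Rmult_le_reg_l with (sqrt (1 + B * x)); [exact Hs|].
        replace (sqrt (1 + B * x) * (6 / sqrt (1 + B * x))) with 6 by (field; lra).
        generalize (Rabs_pos (dirichlet (B * x))). nra. }
      replace (12 * S / sqrt (1 + B * x)) with ((2 * (6 / sqrt (1 + B * x))) * S) by (field; lra).
      apply Rmult_le_compat; [generalize (Rabs_pos (dirichlet (B * x))); lra | apply Cmod_ge_0 | lra | apply HS, Hx].
    + apply (is_RInt_derive (V := R_CompleteNormedModule) (fun x => 24 * S / B * sqrt (1 + B * x))).
      * intros x. rewrite Rmin_left by lra. intros Hx. assert (H1 := Hpos x (proj1 Hx)).
        assert (Hs := sqrt_lt_R0 _ H1).
        auto_derive; [exact H1 | field; lra].
      * intros x. rewrite Rmin_left by lra. intros Hx. assert (H1 := Hpos x (proj1 Hx)).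
        assert (Hs := sqrt_lt_R0 _ H1).
        apply continuous_Rmult; [apply continuous_const|].
        apply continuous_Rinv_comp; [|lra].
        apply (continuous_comp (fun x => 1 + B * x) sqrt); [prove_continuous | apply continuous_sqrt].
  - unfold minus, plus, opp; simpl.
    assert (0 <= 24 * S / B) by (apply Rdiv_le_0_compat; lra).
    assert (Hs := sqrt_pos (1 + B * 0)). nra.
Qed.

Lemma continuous_bounded (f : R -> R) (a b : R) :
  a <= b -> (forall x, continuous f x) -> exists S, forall x, a <= x <= b -> f x <= S.
Proof.
  intros Hab Hf. destruct (continuity_ab_maj f a b Hab) as [z [Hz _]].
  - intros c _. apply continuity_pt_filterlim, Hf.
  - exists (f z). exact Hz.
Qed.

(** The kernel is even, so the left half is the right half for [g (- u)]; hence [2 PI], and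
    [48 = 2 * 24] in the constant. What matters is that [S] does not depend on [B]. *)
Lemma dirichlet_kernel_limit (g dg : R -> C) (W : R) :
  (forall x, derivC g x (dg x)) -> (forall x, contC dg x) ->
  0 < W -> (forall x, W <= Rabs x -> g x = 0%C) ->
  exists S, 0 <= S /\ forall B, 0 < B ->
    Cmod (intC (fun u => dirichlet_kernel B u * g u)%C (- W) W - RtoC (2 * PI) * g 0)%C
    <= S / B * sqrt (1 + B * W).
Proof.
  intros Hg Cdg HW Hs.
  destruct (continuous_bounded (fun x => Cmod (dg x)) (- W) W) as [S HS]; [lra | intros; apply continuous_Cmod, Cdg |].
  assert (HS0 : 0 <= S) by (eapply Rle_trans; [apply Cmod_ge_0 | apply (HS 0); lra]).
  assert (Cg : forall x, contC g x) by (intros x; eapply is_derive_continuousC, Hg).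
  exists (48 * S). split; [lra|]. intros B HB.
  assert (Cker : forall x, contC (fun u : R => dirichlet_kernel B u * g u)%C x).
  { intros x. apply continuous_Cmult; [apply continuous_dirichlet_kernel | apply Cg]. }
  rewrite <- (intC_Chasles _ (- W) 0 W Cker).
  rewrite (intC_comp_opp _ (- W) 0 Cker), Ropp_involutive, Ropp_0.
  rewrite (intC_ext (fun s => dirichlet_kernel B (- s) * g (- s)%R)%C (fun s => dirichlet_kernel B s * g (- s)%R)%C)
    by (intros; rewrite dirichlet_kernel_even; reflexivity).
  assert (Dg' : forall x, derivC (fun x => g (- x)) x (RtoC (-1) * dg (- x)%R)%C).
  { intros x. apply (is_derive_C_comp g Ropp); [apply Hg | auto_derive; [exact I | ring]]. }
  assert (Cdg' : forall x, contC (fun x : R => RtoC (-1) * dg (- x)%R)%C x).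
  { intros x. apply continuous_Cmult; [apply continuous_const|].
    apply (continuous_comp Ropp dg); [apply continuous_Ropp, continuous_id | apply Cdg]. }
  assert (Cker' : forall x, contC (fun u : R => dirichlet_kernel B u * g (- u)%R)%C x).
  { intros x. apply continuous_Cmult; [apply continuous_dirichlet_kernel|]. eapply is_derive_continuousC, Dg'. }
  replace (- intC (fun s => dirichlet_kernel B s * g (- s)%R) W 0)%C
    with (intC (fun s => dirichlet_kernel B s * g (- s)%R)%C 0 W).
  2: { generalize (intC_Chasles _ 0 W 0 Cker'). rewrite intC_point. intros E.
       replace (intC (fun s => dirichlet_kernel B s * g (- s)%R)%C 0 W)
         with ((intC (fun s => dirichlet_kernel B s * g (- s)%R) 0 W + intC (fun s => dirichlet_kernel B s * g (- s)%R) W 0)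
           - intC (fun s => dirichlet_kernel B s * g (- s)%R) W 0)%C by ring.
       rewrite E. ring. }
  assert (A1 := dirichlet_half g dg W S B Hg Cdg HW).
  assert (A2 := dirichlet_half (fun x => g (- x)) _ W S B Dg' Cdg' HW).
  cbv beta in A2. rewrite Ropp_0 in A2.
  replace (_ - _)%C with
    ((intC (fun u => dirichlet_kernel B u * g (- u)%R) 0 W - RtoC PI * g 0) +
     (intC (fun u => dirichlet_kernel B u * g u) 0 W - RtoC PI * g 0))%C
    by (rewrite RtoC_mult; replace (RtoC 2) with (1 + 1)%C by (rewrite <- RtoC_plus; f_equal; ring); ring).
  eapply Rle_trans; [apply Cmod_triangle|].
  replace (48 * S / B * sqrt (1 + B * W)) with (24 * S / B * sqrt (1 + B * W) + 24 * S / B * sqrt (1 + B * W)) by (field; lra).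
  apply Rplus_le_compat.
  - apply A2; [apply Hs; rewrite Rabs_Ropp, Rabs_pos_eq; lra | | exact HB].
    intros x Hx. rewrite Cmod_mult, Cmod_R, Rabs_left by lra.
    replace (- (-1)) with 1 by ring. rewrite Rmult_1_l. apply HS; lra.
  - apply A1; [apply Hs; rewrite Rabs_pos_eq; lra | | exact HB].
    intros x Hx. apply HS; lra.
Qed.

(** * Fourier inversion and the propagator *)

Lemma contC_mult_cis (G : R -> C) (x z : R) :
  (forall z, contC G z) -> contC (fun z : R => cis (x * z) * G z)%C z.
Proof. intros H. apply continuous_Cmult; [apply continuous_cis, continuous_mul_l | apply H]. Qed.

Lemma derive_support (G dG : R -> C) (L : R) :
  (forall z, derivC G z (dG z)) -> (forall z, L < Rabs z -> G z = 0%C) ->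
  forall z, L < Rabs z -> dG z = 0%C.
Proof.
  intros H Hs z Hz. assert (He : 0 < Rabs z - L) by lra.
  apply (is_derive_C_unique G z); [apply H|].
  apply (is_derive_locally_zero G z (mkposreal _ He)). simpl. intros y Hy. apply Hs.
  generalize (Rabs_triang_inv z (z - y)). replace (z - (z - y)) with y by ring.
  rewrite (Rabs_minus_sym z y). lra.
Qed.

Lemma fourier_by_parts (G dG : R -> C) (L x : R) :
  (forall z, derivC G z (dG z)) -> (forall z, contC dG z) -> 0 < L ->
  (forall z, L <= Rabs z -> G z = 0%C) ->
  (Ci * RtoC x * intC (fun z => cis (x * z) * G z) (- L) L)%C = (- intC (fun z => cis (x * z) * dG z)%C (- L)%R L)%C.
Proof.
  intros H C1 HL Hs.
  assert (Cc : forall z, contC (fun z : R => cis (x * z)) z) by (intros; apply continuous_cis, continuous_mul_l).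
  assert (CG : forall z, contC G z) by (intros z; eapply is_derive_continuousC, H).
  rewrite <- intC_scal by (intros; apply contC_mult_cis, CG).
  rewrite (intC_ext _ (fun z => (Ci * RtoC x * cis (x * z)) * G z)%C) by (intros; ring).
  rewrite (intC_by_parts (fun z => cis (x * z)) G _ dG).
  - rewrite (Hs L), (Hs (- L)) by (rewrite ?Rabs_Ropp, Rabs_pos_eq; lra). ring.
  - intros z. apply (is_derive_cis (fun z => x * z)). auto_derive; [exact I | ring].
  - exact H.
  - intros z. apply continuous_Cmult; [apply continuous_const | apply Cc].
  - exact C1.
Qed.

Lemma Cmod_fourier_le (G : R -> C) (L : R) :
  (forall z, contC G z) -> 0 < L -> exists S, forall x,
  Cmod (intC (fun z => cis (x * z) * G z)%C (- L) L) <= S.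
Proof.
  intros H HL. exists (Re (intC (fun z => RtoC (Cmod (G z))) (- L) L)). intros x.
  apply (Cmod_intC_le _ (fun z => Cmod (G z))); [lra | intros; apply contC_mult_cis, H | |].
  - intros z _. rewrite Cmod_mult, Cmod_cis. lra.
  - apply (Re_intC (fun z => RtoC (Cmod (G z)))). intros z. apply continuous_RtoC, continuous_Cmod, H.
Qed.

(** Two integrations by parts identify [- x^2 F(x)] with the transform of [G''], which is bounded.
    The unit margin inside [L] makes [G] and [G'] vanish at the endpoints. *)
Lemma fourier_compact_decay (G : R -> C) (L : R) :
  Ck1 2 G -> 1 < L -> (forall z, L - 1 < Rabs z -> G z = 0%C) ->
  exists M, quadratic_decay (fun x => intC (fun z => cis (x * z) * G z)%C (- L) L) M.
Proof.
  intros [G1 [D1 [G2 [D2 C2]]]] HL Hs. simpl in C2.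
  assert (Hs1 := derive_support G G1 (L - 1) D1 Hs).
  assert (C1 : forall z, contC G1 z) by (intros z; eapply is_derive_continuousC, D2).
  assert (C0 : forall z, contC G z) by (intros z; eapply is_derive_continuousC, D1).
  destruct (Cmod_fourier_le G L C0 ltac:(lra)) as [S0 HS0].
  destruct (Cmod_fourier_le G2 L C2 ltac:(lra)) as [S2 HS2].
  exists (S0 + S2). split.
  - intros x. apply (continuous_intC_param (fun x z => cis (x * z) * G z)%C).
    intros p. apply continuous_Cmult.
    + apply continuous_cis. prove_continuous.
    + apply (continuous_comp snd G); [apply continuous_snd_pt | apply C0].
  - intros x.
    assert (E1 := fourier_by_parts G G1 L x D1 C1 ltac:(lra) ltac:(intros; apply Hs; lra)).
    assert (E2 := fourier_by_parts G1 G2 L x D2 C2 ltac:(lra) ltac:(intros; apply Hs1; lra)).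
    specialize (HS0 x). specialize (HS2 x).
    set (F := intC (fun z => cis (x * z) * G z)%C (- L) L) in *.
    assert (E : (RtoC (- x ^ 2) * F)%C = intC (fun z => cis (x * z) * G2 z)%C (- L) L).
    { replace (RtoC (- x ^ 2) * F)%C with (Ci * RtoC x * (Ci * RtoC x * F))%C
        by (apply injective_projections; simpl; ring).
      rewrite E1.
      replace (Ci * RtoC x * - intC (fun z => cis (x * z) * G1 z) (- L)%R L)%C
        with (- (Ci * RtoC x * intC (fun z => cis (x * z) * G1 z) (- L)%R L))%C by ring.
      rewrite E2. ring. }
    rewrite <- E, Cmod_mult, Cmod_R, Rabs_Ropp, Rabs_pos_eq in HS2 by nra.
    lra.
Qed.

(** Decay of the transform guarantees convergence, so the value can be computed along [(-B, B)],
    where the integral becomes a Dirichlet integral of [G] centred at [xi]. *)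
Lemma fourier_inversion (G : R -> C) (L xi : R) :
  Ck1 2 G -> 1 < L -> (forall z, L - 1 < Rabs z -> G z = 0%C) ->
  fourier (fun x => intC (fun z => cis (x * z) * G z)%C (- L) L) xi = (RtoC (2 * PI) * G xi)%C.
Proof.
  intros HG HL Hs.
  set (F := fun x => intC (fun z => cis (x * z) * G z)%C (- L) L).
  destruct (fourier_compact_decay G L HG HL Hs) as [M HM]. fold F in HM.
  assert (Hlim : improper_limit (fun x => cis (- (x * xi)) * F x)%C (fourier F xi)).
  { apply (quadratic_decay_integral_R _ M).
    apply (quadratic_decay_cis F (fun x => - (x * xi))); [|exact HM]. intros x. prove_continuous. }
  assert (C0 : forall z, contC G z) by (intros z; apply (Ck1_continuous 2), HG).
  destruct HG as [G1 [D1 HG1]].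
  assert (C1 : forall z, contC G1 z) by (intros z; apply (Ck1_continuous 1), HG1).
  (* Large enough for the translate [G (u + xi)] to vanish when [W <= Rabs u]. *)
  set (W := L + Rabs xi). assert (Hxi := Rabs_pos xi). assert (Hxi1 := Rle_abs xi).
  assert (Hxi2 := Rle_abs (- xi)). rewrite Rabs_Ropp in Hxi2.
  assert (HW : 0 < W) by (unfold W; lra).
  destruct (dirichlet_kernel_limit (fun u => G (u + xi)) (fun u => G1 (u + xi)) W) as [S [HS0 HS]].
  { intros x. replace (G1 (x + xi)) with (RtoC 1 * G1 (x + xi)%R)%C by ring.
    apply (is_derive_C_comp G (fun x => x + xi)); [apply D1 | auto_derive; [exact I | ring]]. }
  { intros x. apply (continuous_comp (fun x => x + xi) G1); [prove_continuous | apply C1]. }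
  { exact HW. }
  { intros x Hx. apply Hs. generalize (Rabs_triang_inv x (- xi)). rewrite Rabs_Ropp.
    replace (x - - xi) with (x + xi) by ring. unfold W in Hx. lra. }
  assert (swap : forall B, intC (fun x => cis (- (x * xi)) * F x)%C (- B) B
      = intC (fun u => dirichlet_kernel B u * G (u + xi)%R)%C (- W) W).
  { intros B.
    assert (C2 : contC2 (fun x z : R => cis (x * (z + - xi)) * G z)%C).
    { intros p. apply continuous_Cmult.
      - apply continuous_cis. prove_continuous.
      - apply (continuous_comp snd G); [apply continuous_snd_pt | apply C0]. }
    transitivity (intC (fun x => intC (fun z => cis (x * (z + - xi)) * G z)%C (- L) L) (- B) B).
    { apply intC_ext. intros x _. unfold F.
      rewrite <- intC_scal by (intros; apply contC_mult_cis, C0).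
      apply intC_ext. intros z _. rewrite Cmult_assoc, <- cis_plus. f_equal. f_equal. ring. }
    rewrite intC_Fubini by exact C2.
    transitivity (intC (fun z => dirichlet_kernel B (z + - xi) * G z)%C (- L) L).
    { apply intC_ext. intros z _. unfold dirichlet_kernel.
      rewrite (Cmult_comm (intC _ _ _)).
      rewrite <- intC_scal.
      - apply intC_ext. intros; ring.
      - intros x. apply continuous_cis. prove_continuous. }
    assert (Cker : forall z, contC (fun z : R => dirichlet_kernel B (z + - xi) * G z)%C z).
    { intros z. apply continuous_Cmult; [|apply C0].
      apply (continuous_comp (fun z => z + - xi) (dirichlet_kernel B)); [prove_continuous | apply continuous_dirichlet_kernel]. }
    rewrite <- (intC_support _ L (- W + xi) (W + xi) Cker); [| | lra | unfold W; lra | unfold W; lra].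
    - rewrite <- (intC_comp_lin _ (- W) W xi Cker). apply intC_ext. intros u _.
      f_equal. f_equal. ring.
    - intros z Hz. rewrite (Hs z) by lra. ring. }
  cbv beta in HS. rewrite Rplus_0_l in HS.
  assert (Hz : Cmod (fourier F xi - RtoC (2 * PI) * G xi)%C = 0).
  { apply Rle_antisym; [|apply Cmod_ge_0].
    apply Rle_plus_epsilon. intros eps He. rewrite Rplus_0_l.
    destruct (Hlim (eps / 2) ltac:(lra)) as [N HN].
    set (d := eps / (2 * (S + 1))).
    assert (Hd : 0 < d) by (apply Rdiv_lt_0_compat; lra).
    assert (Hd2 : 0 < d * d) by nra.
    (* Beyond [N] the truncation is close to the transform. The last term forces [1 + W <= d^2 B],
       hence [sqrt (1 + B * W) <= d * B], and the kernel error is at most [S * d]. *)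
    set (B := Rabs N + 1 + (1 + W) / (d * d)).
    assert (Hq : 0 < (1 + W) / (d * d)) by (apply Rdiv_lt_0_compat; lra).
    assert (HNa := Rle_abs N). assert (HNp := Rabs_pos N).
    assert (HB1 : 1 <= B) by (unfold B; lra).
    assert (HBN : N < B) by (unfold B; lra).
    specialize (HN (- B) B ltac:(lra) HBN). specialize (HS B ltac:(lra)).
    rewrite swap in HN.
    assert (Hsq : sqrt (1 + B * W) <= d * B).
    { rewrite <- (sqrt_square (d * B)) by nra. apply sqrt_le_1_alt.
      assert (1 + W <= d * d * B).
      { replace (1 + W) with (d * d * ((1 + W) / (d * d))) by (field; lra).
        apply Rmult_le_compat_l; [lra | unfold B; lra]. }
      nra. }
    assert (Hfin : S / B * sqrt (1 + B * W) <= eps / 2).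
    { apply Rle_trans with (S / B * (d * B)).
      - apply Rmult_le_compat_l; [apply Rdiv_le_0_compat; lra | exact Hsq].
      - replace (S / B * (d * B)) with (S * d) by (field; lra).
        unfold d. apply Rmult_le_reg_r with (2 * (S + 1)); [lra|].
        replace (S * (eps / (2 * (S + 1))) * (2 * (S + 1))) with (S * eps) by (field; lra).
        replace (eps / 2 * (2 * (S + 1))) with (S * eps + eps) by field. lra. }
    set (I0 := intC (fun u => dirichlet_kernel B u * G (u + xi)%R)%C (- W) W) in *.
    replace (fourier F xi - RtoC (2 * PI) * G xi)%C
      with (- (I0 - fourier F xi) + (I0 - RtoC (2 * PI) * G xi))%C by ring.
    eapply Rle_trans; [apply Cmod_triangle|]. rewrite Cmod_opp. lra. }
  apply Cmod_eq_0 in Hz.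
  replace (fourier F xi) with ((fourier F xi - RtoC (2 * PI) * G xi) + RtoC (2 * PI) * G xi)%C by ring.
  rewrite Hz. ring.
Qed.

(** The substitution [z = x + y] at fixed [y] is a translation, framed by two uses of Fubini. Since
    [2 K <= L], the window for [z] contains every translate of [(-K, K)] by [y] in [(-K, K)]. *)
Lemma intC2_change_variables (p : R -> C) (M : R -> R -> C) (K L : R) :
  (forall z, contC p z) -> contC2 M -> 0 <= K -> 2 * K <= L ->
  (forall x y, K < Rabs x \/ K < Rabs y -> M x y = 0%C) ->
  intC (fun x => intC (fun y => p (x + y)%R * M x y)%C (- K) K) (- K) K
  = intC (fun z => p z * intC (fun y => M (z - y)%R y) (- K)%R K)%C (- L) L.
Proof.
  intros Hp HM HK HL Hs.
  assert (C1 : contC2 (fun x y => p (x + y)%R * M x y)%C).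
  { intros q. apply continuous_Cmult; [|apply HM].
    apply (continuous_comp (fun q : R * R => fst q + snd q) p); [prove_continuous | apply Hp]. }
  assert (C3 : contC2 (fun z y => M (z - y)%R y)).
  { intros q. apply (contC2_comp M (fun q : R * R => fst q - snd q) snd); [exact HM | | apply continuous_snd_pt].
    unfold Rminus. prove_continuous. }
  assert (C2 : contC2 (fun z y : R => p z * M (z - y)%R y)%C).
  { intros q. apply continuous_Cmult; [|apply C3].
    apply (continuous_comp fst p); [apply continuous_fst_pt | apply Hp]. }
  rewrite intC_Fubini by exact C1.
  transitivity (intC (fun z => intC (fun y => p z * M (z - y)%R y)%C (- K) K) (- L) L).
  - rewrite (intC_Fubini (fun z y => p z * M (z - y)%R y)%C) by exact C2.
    apply intC_ext. intros y. rewrite Rmin_left, Rmax_right by lra. intros Hy.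
    rewrite <- (intC_support _ K (- L - y) (L - y)); try lra.
    + assert (E := intC_comp_lin (fun z => p z * M (z - y)%R y)%C (- L - y) (L - y) y
        (fun z => contC2_l (fun z y => p z * M (z - y)%R y)%C z y C2)).
      replace (- L - y + y) with (- L) in E by ring. replace (L - y + y) with L in E by ring.
      rewrite <- E. apply intC_ext. intros x _. f_equal. f_equal. ring.
    + intros x. apply (contC2_l (fun x y => p (x + y)%R * M x y)%C), C1.
    + intros x Hx. rewrite Hs by (left; exact Hx). ring.
  - apply intC_ext. intros z _. apply intC_scal. intros y. apply (contC2_r (fun z y => M (z - y)%R y)), C3.
Qed.

(** Everything in the multiplier integral except the exponential in [x], normalisation included: the
    [M] of the estimates when [sigma] is [m / phi]. *)
Definition bilinear_density (sigma : R -> R -> C) (f g : R -> C) (xi eta : R) : C :=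
  (RtoC (/ (2 * PI) ^ 2) * (fourier f xi * fourier g eta * sigma xi eta))%C.

Lemma bilinear_eq (sigma : R -> R -> C) (f g : R -> C) (K x : R) :
  contC2 (bilinear_density sigma f g) -> 0 <= K ->
  (forall xi eta, K < Rabs xi \/ K < Rabs eta -> sigma xi eta = 0%C) ->
  bilinear sigma f g x
  = intC (fun xi => intC (fun eta => cis (x * (xi + eta)) * bilinear_density sigma f g xi eta)%C (- K) K) (- K) K.
Proof.
  intros Hc HK Hs.
  set (h := fun xi eta => (cis (x * (xi + eta)) * fourier f xi * fourier g eta * sigma xi eta)%C).
  assert (Hpi := PI_RGT_0).
  assert (Hn : RtoC ((2 * PI) ^ 2) <> 0%C).
  { intros E. apply (f_equal Re) in E. revert E. apply pow_nonzero. lra. }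
  assert (Ch : contC2 h).
  (* Continuity is known for the normalised density; multiplying back by [(2 PI)^2] recovers it for
     the raw integrand. *)
  { intros q. apply (continuous_ext (U := C_R_NormedModule)
      (fun q : R * R => RtoC ((2 * PI) ^ 2) * (cis (x * (fst q + snd q)) * bilinear_density sigma f g (fst q) (snd q)))%C).
    - intros [u v]. unfold h, bilinear_density. simpl fst; simpl snd. rewrite RtoC_inv by (apply pow_nonzero; lra).
      lazymatch goal with |- ?l = ?r => change (@eq C l r) end. field. exact Hn.
    - apply continuous_Cmult; [apply continuous_const|]. apply continuous_Cmult; [|apply Hc].
      apply continuous_cis. prove_continuous. }
  assert (inner : forall xi, integral_R (h xi) = intC (h xi) (- K) K).
  { intros xi. apply integral_R_support.
    - intros. apply contC2_r, Ch.
    - intros eta He. unfold h. rewrite Hs by (right; exact He). ring.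
    - exact HK. }
  assert (Co : forall xi, contC (fun xi : R => integral_R (h xi)) xi).
  { intros xi. apply (continuous_ext (U := C_R_NormedModule) (fun xi => intC (h xi) (- K) K)).
    - intros xi'. symmetry. apply inner.
    - apply continuous_intC_param, Ch. }
  unfold bilinear. change (RtoC (/ (2 * PI) ^ 2) * integral_R (fun xi => integral_R (h xi)) =
    intC (fun xi => intC (fun eta => cis (x * (xi + eta)) * bilinear_density sigma f g xi eta) (- K) K) (- K)%R K)%C.
  rewrite (integral_R_support _ K).
  - rewrite <- intC_scal by exact Co. apply intC_ext. intros xi _. rewrite inner.
    rewrite <- intC_scal by (intros; apply contC2_r, Ch).
    apply intC_ext. intros eta _. unfold h, bilinear_density. ring.
  - exact Co.
  (* Even the zero function needs a convergence argument under [integral_R]; support radius 0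
     supplies it. *)
  - intros xi Hxi. transitivity (integral_R (fun _ => RtoC 0)).
    + f_equal. apply functional_extensionality. intros eta. unfold h. rewrite Hs by (left; exact Hxi). ring.
    + rewrite (integral_R_support _ 0).
      * apply intC_zero.
      * intros; apply continuous_const.
      * reflexivity.
      * lra.
  - exact HK.
Qed.

(** Grouping frequencies by [z = xi + eta] writes the bilinear output as an unnormalised inverse
    transform of a [C^2] function [G]. Inversion makes the propagator a multiplication of [G] by
    [cis (t * a z)], and the grouping is then undone. *)
Lemma propagator_bilinear (a : R -> R) (t : R) (sigma : R -> R -> C) (f g : R -> C) (K x : R) :
  (forall z, continuous a z) -> Ck 2 (bilinear_density sigma f g) -> 0 <= K ->
  (forall xi eta, K < Rabs xi \/ K < Rabs eta -> sigma xi eta = 0%C) ->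
  propagator a t (bilinear sigma f g) x
  = intC (fun xi => intC (fun eta =>
      (cis (x * (xi + eta)) * cis (t * a (xi + eta)%R)) * bilinear_density sigma f g xi eta)%C (- K) K) (- K) K.
Proof.
  intros Ha HM HK Hs. assert (Hpi := PI_RGT_0).
  set (M := bilinear_density sigma f g) in *.
  assert (CM := Ck_continuous _ _ HM).
  assert (HsM : forall u v, K < Rabs u \/ K < Rabs v -> M u v = 0%C).
  { intros u v H. unfold M, bilinear_density. rewrite Hs by exact H. ring. }
  set (G := fun z => intC (fun y => M (z - y)%R y) (- K) K).
  (* [G] vanishes beyond [2 K]; the excess 2 provides the unit margin and [1 < L] even when
     [K = 0]. *)
  set (L := 2 * K + 2).
  assert (HG : Ck1 2 G) by (apply Ck1_convolution, HM).
  assert (CG : forall z, contC G z) by (intros z; apply (Ck1_continuous 2), HG).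
  assert (HGs : forall z, L - 1 < Rabs z -> G z = 0%C).
  { intros z Hz. unfold G. rewrite (intC_ext _ (fun _ => RtoC 0)); [apply intC_zero|].
    intros y. rewrite Rmin_left, Rmax_right by lra. intros Hy. apply HsM. left.
    generalize (Rabs_triang_inv z y). assert (Rabs y <= K) by (apply Rabs_le; lra). unfold L in Hz. lra. }
  assert (EF : bilinear sigma f g = fun x => intC (fun z => cis (x * z) * G z)%C (- L) L).
  { apply functional_extensionality. intros y.
    rewrite (bilinear_eq sigma f g K y CM HK Hs).
    apply (intC2_change_variables (fun z => cis (y * z)) M K L); try assumption; [|unfold L; lra].
    intros z. apply continuous_cis. prove_continuous. }
  rewrite EF. unfold propagator, inv_fourier.
  set (p := fun z => (cis (x * z) * cis (t * a z))%C).
  assert (Cp : forall z, contC p z).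
  { intros z. apply continuous_Cmult; apply continuous_cis; [prove_continuous|].
    apply continuous_Rmult; [apply continuous_const | apply Ha]. }
  transitivity (intC (fun z => p z * G z)%C (- L) L).
  - replace (fun xi => (cis (x * xi) * (cis (t * a xi) * fourier (fun x0 => intC (fun z => cis (x0 * z) * G z) (- L) L) xi))%C)
      with (fun z => (RtoC (2 * PI) * (p z * G z))%C).
    + rewrite (integral_R_support _ L).
      * rewrite intC_scal by (intros; apply continuous_Cmult; auto).
        rewrite Cmult_assoc, <- RtoC_mult. replace (/ (2 * PI) * (2 * PI)) with 1 by (field; lra). ring.
      * intros z. apply continuous_Cmult; [apply continuous_const | apply continuous_Cmult; auto].
      * intros z Hz. rewrite HGs by lra. ring.
      * unfold L; lra.
    + apply functional_extensionality. intros z.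
      rewrite fourier_inversion; [unfold p; ring | exact HG | unfold L; lra | exact HGs].
  - symmetry. apply (intC2_change_variables p M K L); try assumption. unfold L; lra.
Qed.

(** * The asymptotics of the solution *)

Lemma intC_cis_mul (p t : R) : p <> 0 ->
  intC (fun s => cis (s * p)) 0 t = (- Ci * (cis (t * p) - 1) / RtoC p)%C.
Proof.
  intros Hp. assert (Hn : RtoC p <> 0%C) by (intros E; apply (f_equal Re) in E; exact (Hp E)).
  rewrite (intC_ext _ (fun s => (- Ci / RtoC p) * (Ci * RtoC p * cis (s * p)))%C).
  - rewrite intC_scal.
    + rewrite (intC_derive (fun s => cis (s * p))).
      * rewrite Rmult_0_l, cis_0. unfold Cdiv. ring.
      * intros s. apply (is_derive_cis (fun s => s * p)). auto_derive; [exact I | ring].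
      * intros s. apply continuous_Cmult; [apply continuous_const | apply continuous_cis; prove_continuous].
    + intros s. apply continuous_Cmult; [apply continuous_const | apply continuous_cis; prove_continuous].
  - intros s _. replace (- Ci / RtoC p * (Ci * RtoC p * cis (s * p)))%C
      with (- (Ci * Ci) * cis (s * p))%C by (field; exact Hn).
    replace (Ci * Ci)%C with (- (1))%C by (apply injective_projections; simpl; ring). ring.
Qed.

(* The integral of [m e^(i s phi)] over [0 <= s <= t], written with the junk value [0] where [m = phi = 0]. *)
Definition duhamel_symbol (m : R -> R -> C) (phi : R -> R -> R) (t xi eta : R) : C :=
  (- Ci * (m xi eta / RtoC (phi xi eta)) * (cis (t * phi xi eta) - 1))%C.

(** With both frequencies in a compact square, Fubini brings the time integral inside: past [xi]
    first, then past [eta]. There it acts on [cis (s * phi)] alone. *)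
Lemma intC_bilinear (m : R -> R -> C) (phi : R -> R -> R) (f g : R -> C) (K t x : R) :
  contC2 (bilinear_density m f g) ->
  contC2 (bilinear_density (duhamel_symbol m phi t) f g) ->
  (forall p : R * R, continuous (fun q => phi (fst q) (snd q)) p) -> 0 <= K ->
  (forall xi eta, K < Rabs xi \/ K < Rabs eta -> m xi eta = 0%C) ->
  (forall xi eta, m xi eta <> 0%C -> phi xi eta <> 0) ->
  intC (fun s => bilinear (fun xi eta => m xi eta * cis (s * phi xi eta))%C f g x) 0 t
  = bilinear (duhamel_symbol m phi t) f g x.
Proof.
  intros Cm Cd Cphi HK Hs Hphi.
  set (N := fun s xi eta => (cis (x * (xi + eta)) * (bilinear_density m f g xi eta * cis (s * phi xi eta)))%C).
  (* Continuity in all three variables, with [(s, xi)] paired: the inner integral must be jointly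
     continuous in [s] and [xi] for the first exchange. *)
  assert (CN : contC2 (fun (q : R * R) eta => N (fst q) (snd q) eta)).
  { intros q. apply continuous_Cmult.
    - apply continuous_cis. apply continuous_Rmult; [apply continuous_const|].
      apply continuous_Rplus; [|apply continuous_snd_pt].
      apply (continuous_comp fst snd); apply continuous_fst_pt || apply continuous_snd_pt.
    - assert (Cxy : continuous (fun q : (R * R) * R => snd (fst q)) q).
      { apply (continuous_comp fst snd); apply continuous_fst_pt || apply continuous_snd_pt. }
      apply continuous_Cmult.
      + apply (contC2_comp (bilinear_density m f g) (fun q : (R * R) * R => snd (fst q)) snd);
          [exact Cm | exact Cxy | apply continuous_snd_pt].
      + apply continuous_cis. apply continuous_Rmult.
        * apply (continuous_comp fst fst); apply continuous_fst_pt.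
        * apply (continuous_comp_2 (fun q : (R * R) * R => snd (fst q)) snd phi);
            [exact Cxy | apply continuous_snd_pt | apply Cphi]. }
  assert (CN3 : forall xi, contC2 (fun s eta => N s xi eta)).
  { intros xi q. apply (continuous_comp (fun q : R * R => ((fst q, xi), snd q)) (fun q : (R * R) * R => N (fst (fst q)) (snd (fst q)) (snd q))).
    - apply (continuous_comp_2 (fun q : R * R => (fst q, xi)) snd (fun (a : R * R) (b : R) => (a, b))).
      + apply (continuous_comp_2 fst (fun _ => xi) (fun (a b : R) => (a, b))).
        * apply continuous_fst_pt.
        * apply continuous_const.
        * apply (continuous_ext (fun q => q)); [intros []; reflexivity | apply continuous_id].
      + apply continuous_snd_pt.
      + apply (continuous_ext (fun q => q)); [intros []; reflexivity | apply continuous_id].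
    - apply CN. }
  transitivity (intC (fun s => intC (fun xi => intC (N s xi) (- K) K) (- K) K) 0 t).
  { apply intC_ext. intros s _.
    assert (E : forall xi eta, bilinear_density (fun xi eta => m xi eta * cis (s * phi xi eta))%C f g xi eta
        = (bilinear_density m f g xi eta * cis (s * phi xi eta))%C).
    { intros xi eta. unfold bilinear_density. ring. }
    rewrite (bilinear_eq _ f g K x).
    - apply intC_ext. intros xi _. apply intC_ext. intros eta _. unfold N. rewrite E. reflexivity.
    - intros q. apply (continuous_ext (U := C_R_NormedModule)
        (fun q : R * R => bilinear_density m f g (fst q) (snd q) * cis (s * phi (fst q) (snd q)))%C).
      + intros [u v]. symmetry. apply E.
      + apply continuous_Cmult; [apply Cm|]. apply continuous_cis.
        apply continuous_Rmult; [apply continuous_const | apply Cphi].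
    - exact HK.
    - intros xi eta H. rewrite Hs by exact H. ring. }
  rewrite (intC_Fubini (fun s xi => intC (N s xi) (- K) K)).
  2: { intros q. apply (continuous_intC_param (fun (q : R * R) eta => N (fst q) (snd q) eta)), CN. }
  rewrite (bilinear_eq _ f g K x Cd HK).
  2: { intros xi eta H. unfold duhamel_symbol. rewrite Hs by exact H. unfold Cdiv. ring. }
  apply intC_ext. intros xi _. rewrite (intC_Fubini (fun s eta => N s xi eta)) by apply CN3.
  apply intC_ext. intros eta _. unfold N.
  rewrite (intC_ext _ (fun s => (cis (x * (xi + eta)) * bilinear_density m f g xi eta) * cis (s * phi xi eta))%C)
    by (intros; ring).
  rewrite intC_scal by (intros; apply continuous_cis; prove_continuous).
  unfold bilinear_density, duhamel_symbol.
  destruct (classic (m xi eta = 0%C)) as [H0|H0].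
  - rewrite H0. unfold Cdiv. ring.
  - rewrite intC_cis_mul by (apply Hphi, H0). unfold Cdiv. ring.
Qed.

(** The linear term [x * s] does not affect the second derivative, so the test applies with
    [lam = t * delta] for every [x]. *)
Lemma oscillation_primitive (b : R -> R) (delta x t : R) :
  smooth b -> 0 < delta -> (forall s, delta <= Rabs (Derive_n b 2 s)) -> 0 < t ->
  exists E : R -> C, (forall s, derivC E s (cis (x * s + t * b s))) /\
    forall s, Cmod (E s) <= 3 / sqrt (t * delta).
Proof.
  intros Hb Hd Hb2 Ht.
  assert (D1 : forall s, is_derive b s (Derive_n b 1 s)) by (intros s; apply Derive_correct, (Hb 1%nat)).
  assert (D2 : forall s, is_derive (Derive_n b 1) s (Derive_n b 2 s)) by (intros s; apply Derive_correct, (Hb 2%nat)).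
  assert (D3 : forall s, is_derive (Derive_n b 2) s (Derive_n b 3 s)) by (intros s; apply Derive_correct, (Hb 3%nat)).
  apply (van_der_Corput (fun s => x * s + t * b s) (fun s => x + t * Derive_n b 1 s) (fun s => t * Derive_n b 2 s)).
  - intros s. apply (is_derive_plus (V := R_NormedModule) (fun s => x * s) (fun s => t * b s)).
    + auto_derive; [exact I | ring].
    + apply is_derive_scal, D1.
  - intros s. replace (t * Derive_n b 2 s) with (plus 0 (t * Derive_n b 2 s)) by (unfold plus; simpl; ring).
    apply (is_derive_plus (V := R_NormedModule) (fun _ => x) (fun s => t * Derive_n b 1 s)).
    + apply (is_derive_const (V := R_NormedModule)).
    + apply is_derive_scal, D2.
  - intros s. apply continuous_Rmult; [apply continuous_const|].
    apply (ex_derive_continuous (V := R_NormedModule)). eexists; apply D3.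
  - apply Rmult_lt_0_compat; assumption.
  - intros s. rewrite Rabs_mult, (Rabs_pos_eq t) by lra. apply Rmult_le_compat_l; [lra | apply Hb2].
Qed.

Lemma smooth_continuous (a : R -> R) (x : R) : smooth a -> continuous a x.
Proof. intros H. apply (ex_derive_continuous (V := R_NormedModule)), (H 1%nat). Qed.

(** Each summand is a smooth function of a linear form, with coefficients [(1, 1)], [(1, 0)] and
    [(0, 1)]. *)
Lemma Ck_phase (n : nat) (a b c : R -> R) :
  smooth a -> smooth b -> smooth c -> Ck n (fun xi eta => RtoC (phase a b c xi eta)).
Proof.
  intros Ha Hb Hc.
  apply (Ck_ext n (fun xi eta => (- (1) * RtoC (a (1 * xi + 1 * eta)%R) + RtoC (b (1 * xi + 0 * eta)%R))
     + RtoC (c (0 * xi + 1 * eta)%R))%C).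
  - intros xi eta. unfold phase. rewrite !Rmult_1_l, !Rmult_0_l, Rplus_0_r, Rplus_0_l, !RtoC_plus, RtoC_opp. ring.
  - apply Ck_plus; [apply Ck_plus; [apply Ck_mult; [apply Ck_const|]|]|];
    apply (Ck_lin n (fun x => RtoC (_ x))), Ck1_smooth; assumption.
Qed.

Lemma Ck_bilinear_density (n : nat) (sigma : R -> R -> C) (f g : R -> C) :
  schwartz f -> schwartz g -> Ck n sigma -> Ck n (bilinear_density sigma f g).
Proof.
  intros Hf Hg Hs. unfold bilinear_density.
  apply Ck_mult; [apply Ck_const|]. apply Ck_mult; [|exact Hs].
  apply (Ck_ext n (fun xi eta => fourier f (1 * xi + 0 * eta)%R * fourier g (0 * xi + 1 * eta)%R)%C).
  - intros xi eta. rewrite !Rmult_1_l, !Rmult_0_l, Rplus_0_r, Rplus_0_l. reflexivity.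
  - apply Ck_mult; apply Ck_lin, Ck1_fourier, schwartz_rapid; assumption.
Qed.

Lemma intC2_lin (k : C) (h1 h2 : R -> R -> C) (K : R) :
  contC2 h1 -> contC2 h2 ->
  (k * intC (fun x => intC (h1 x) (- K) K) (- K)%R K - intC (fun x => intC (h2 x) (- K) K) (- K)%R K)%C
  = intC (fun x => intC (fun y => k * h1 x y - h2 x y)%C (- K) K) (- K) K.
Proof.
  intros H1 H2.
  assert (C1 : forall x, contC (fun x => intC (h1 x) (- K) K) x) by (intros; apply continuous_intC_param, H1).
  assert (C2 : forall x, contC (fun x => intC (h2 x) (- K) K) x) by (intros; apply continuous_intC_param, H2).
  rewrite <- intC_scal by exact C1.
  rewrite <- intC_minus; [|intros; apply continuous_Cmult; [apply continuous_const | apply C1] | exact C2].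
  apply intC_ext. intros x _.
  rewrite <- intC_scal by (intros; apply contC2_r, H1).
  rewrite <- intC_minus; [reflexivity | |].
  - intros y. apply continuous_Cmult; [apply continuous_const | apply contC2_r, H1].
  - intros y. apply contC2_r, H2.
Qed.

Theorem theorem2p2 (a b c : R -> R) (m : R -> R -> C) (f g : R -> C) :
  smooth a -> smooth b -> smooth c ->
  second_deriv_away_from_zero a ->
  second_deriv_away_from_zero b ->
  second_deriv_away_from_zero c ->
  smooth2 m -> compact_support2 m ->
  schwartz f -> schwartz g ->
  (forall xi eta, in_supp m xi eta -> phase a b c xi eta <> 0) ->
  let F := bilinear (fun xi eta => (m xi eta / RtoC (phase a b c xi eta))%C) f g in
  exists K T0 : R, 0 < T0 /\
    forall t : R, T0 <= t -> forall x : R,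
      Cmod (solution a b c m f g t x - propagator a t F x)%C <= K / t.
Proof.
  intros Ha Hb Hc _ [db [Hdb Hb2]] [dc [Hdc Hc2]] Hm [K0 HK0] Hf Hg Hphi F.
  set (phi := phase a b c) in *.
  (* Strictly larger than [K0], so that [m] vanishes also on the boundary of the square, as the
     integrations by parts require. *)
  set (K := Rabs K0 + 1).
  assert (HK : 0 < K) by (unfold K; generalize (Rabs_pos K0); lra).
  assert (Hs : forall xi eta, K <= Rabs xi \/ K <= Rabs eta -> m xi eta = 0%C).
  { intros xi eta H. apply HK0. generalize (Rle_abs K0). unfold K in H. intros. destruct H; [left|right]; lra. }
  assert (Hs' : forall xi eta, K < Rabs xi \/ K < Rabs eta -> m xi eta = 0%C).
  { intros xi eta H. apply Hs. destruct H; [left|right]; lra. }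
  assert (Hm0 : forall xi eta, m xi eta <> 0%C -> phi xi eta <> 0).
  { intros xi eta H. apply Hphi. intros eps He. exists xi, eta. rewrite !Rminus_diag, Rabs_R0. auto. }
  assert (Cphi : Ck 2 (fun xi eta => RtoC (phi xi eta))) by (apply Ck_phase; assumption).
  assert (Cm : Ck 2 m) by (apply Ck_smooth2, Hm).
  set (mu := fun xi eta => (m xi eta / RtoC (phi xi eta))%C).
  (* Nonvanishing of [phi] on the closed support, limit points included, keeps the quotient [C^2] up
     to the edge of the set where [m] is nonzero. *)
  assert (Cmu : Ck 2 mu) by (apply Ck_div; assumption).
  assert (Ccis : forall t, Ck 2 (fun xi eta => cis (t * phi xi eta))).
  { intros t. apply Ck_cis. apply (Ck_ext 2 (fun xi eta => RtoC t * RtoC (phi xi eta))%C).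
    - intros. symmetry. apply RtoC_mult.
    - apply Ck_mult; [apply Ck_const | exact Cphi]. }
  assert (Cduh : forall t, Ck 2 (duhamel_symbol m phi t)).
  { intros t. unfold duhamel_symbol. apply Ck_mult; [apply Ck_mult; [apply Ck_const | exact Cmu]|].
    apply (Ck_ext 2 (fun xi eta => cis (t * phi xi eta) + - (1))%C); [reflexivity|].
    apply Ck_plus; [apply Ccis | apply Ck_const]. }
  assert (Cden := Ck_bilinear_density 2 mu f g Hf Hg Cmu).
  assert (Hsmu : forall xi eta, K <= Rabs xi \/ K <= Rabs eta -> mu xi eta = 0%C).
  { intros xi eta H. unfold mu. rewrite Hs by exact H. unfold Cdiv. ring. }
  destruct (double_oscillation_bound (bilinear_density mu f g) K Cden HK) as [S HS].
  { intros xi eta H. unfold bilinear_density. rewrite Hsmu by exact H. ring. }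
  (* The product of the two primitive bounds [3 / sqrt (t * db)] and [3 / sqrt (t * dc)] with [S];
     the choice [T0 = 1] only keeps [t] positive. *)
  exists (9 * S / (sqrt db * sqrt dc)), 1. split; [lra|]. intros t Ht x.
  assert (Ca : forall z, continuous a z) by (intros z; apply smooth_continuous, Ha).
  assert (Edu : propagator a t (fun y => integral_0t (fun s => bilinear (fun xi eta => (m xi eta * cis (s * phi xi eta))%C) f g y) t)
     = propagator a t (bilinear (duhamel_symbol m phi t) f g)).
  { f_equal. apply functional_extensionality. intros y.
    apply (intC_bilinear m phi f g K t y).
    - apply (Ck_continuous 2), Ck_bilinear_density; assumption.
    - apply (Ck_continuous 2), Ck_bilinear_density; [assumption | assumption | apply Cduh].
    - intros p. apply (continuous_Re (fun q : R * R => RtoC (phi (fst q) (snd q)))). apply (Ck_continuous 2 _ Cphi).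
    - lra.
    - exact Hs'.
    - exact Hm0. }
  unfold solution. fold phi. rewrite Edu. change F with (bilinear mu f g).
  assert (Cosc : forall sigma, Ck 2 sigma ->
    contC2 (fun xi eta : R => (cis (x * (xi + eta)) * cis (t * a (xi + eta)%R)) * bilinear_density sigma f g xi eta)%C).
  { intros sigma Hsig q. apply continuous_Cmult; [apply continuous_Cmult; apply continuous_cis|].
    - prove_continuous.
    - apply continuous_Rmult; [apply continuous_const|].
      apply (continuous_comp (fun q : R * R => fst q + snd q) a); [prove_continuous | apply Ca].
    - apply (Ck_continuous 2 _ (Ck_bilinear_density 2 sigma f g Hf Hg Hsig)). }
  rewrite (propagator_bilinear a t (duhamel_symbol m phi t) f g K x Ca); [ | | lra | ].
  2: { apply Ck_bilinear_density; [assumption | assumption | apply Cduh]. }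
  2: { intros xi eta H. unfold duhamel_symbol. rewrite Hs' by exact H. unfold Cdiv. ring. }
  rewrite (propagator_bilinear a t mu f g K x Ca); [ | exact Cden | lra | ].
  2: { intros xi eta H. apply Hsmu. destruct H; [left|right]; lra. }
  assert (Elin := intC2_lin (- Ci)%C _ _ K (Cosc _ (Cduh t)) (Cosc mu Cmu)). cbv beta in Elin.
  rewrite Elin. clear Elin.
  destruct (oscillation_primitive b db x t Hb Hdb Hb2 ltac:(lra)) as [E1 [DE1 BE1]].
  destruct (oscillation_primitive c dc x t Hc Hdc Hc2 ltac:(lra)) as [E2 [DE2 BE2]].
  set (w := fun xi eta : R => (cis (x * xi + t * b xi) * cis (x * eta + t * c eta) * bilinear_density mu f g xi eta)%C).
  (* The prefactor [- i] of Duhamel's formula meets the [- i] of the time integral: [- mu (e^(i t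
     phi) - 1) - mu = - mu e^(i t phi)], so the stationary part is exactly the propagated [F]. *)
  replace (intC _ (- K) K) with (- (1) * intC (fun xi => intC (w xi) (- K) K) (- K)%R K)%C.
  - rewrite Cmod_mult, Cmod_opp, Cmod_1, Rmult_1_l.
    eapply Rle_trans; [apply (HS E1 E2 (fun s => cis (x * s + t * b s)) (fun s => cis (x * s + t * c s)))|]; try eassumption.
    + intros s. apply continuous_cis, continuous_Rplus; [prove_continuous|].
      apply continuous_Rmult; [apply continuous_const | apply smooth_continuous, Hb].
    + intros s. apply continuous_cis, continuous_Rplus; [prove_continuous|].
      apply continuous_Rmult; [apply continuous_const | apply smooth_continuous, Hc].
    + rewrite !sqrt_mult by lra.
      assert (Hst := sqrt_lt_R0 t ltac:(lra)). assert (Hsb := sqrt_lt_R0 db Hdb). assert (Hsc := sqrt_lt_R0 dc Hdc).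
      right. rewrite <- (sqrt_sqrt t) at 3 by lra. field. lra.
  - assert (Cfin : contC2 w).
    { intros q. apply continuous_Cmult; [apply continuous_Cmult; apply continuous_cis|].
      - apply continuous_Rplus; [prove_continuous|]. apply continuous_Rmult; [apply continuous_const|].
        apply (continuous_comp fst b); [apply continuous_fst_pt | apply smooth_continuous, Hb].
      - apply continuous_Rplus; [prove_continuous|]. apply continuous_Rmult; [apply continuous_const|].
        apply (continuous_comp snd c); [apply continuous_snd_pt | apply smooth_continuous, Hc].
      - apply (Ck_continuous 2 _ Cden). }
    rewrite <- intC_scal by (intros; apply continuous_intC_param, Cfin).
    apply intC_ext. intros xi _.
    rewrite <- intC_scal by (intros; apply contC2_r, Cfin).
    apply intC_ext. intros eta _. unfold w.
    replace (cis (x * xi + t * b xi) * cis (x * eta + t * c eta))%C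
      with (cis (x * (xi + eta)) * cis (t * a (xi + eta)%R) * cis (t * phi xi eta))%C.
    + unfold bilinear_density, duhamel_symbol. fold (mu xi eta).
      (* [ring] treats [Ci] as an atom, so its square is supplied by hand. *)
      assert (HCi : (Ci * Ci)%C = (- (1))%C) by (apply injective_projections; simpl; ring).
      assert (HCi2 : forall z, (- Ci * (- Ci * z))%C = (- z)%C).
      { intros z. replace (- Ci * (- Ci * z))%C with (Ci * Ci * z)%C by ring. rewrite HCi. ring. }
      match goal with |- _ = (- Ci * ?w - ?v)%C =>
        replace w with (- Ci * (cis (x * (xi + eta)) * cis (t * a (xi + eta)%R) *
          (RtoC (/ (2 * PI) ^ 2) * (fourier f xi * fourier g eta * (mu xi eta * (cis (t * phi xi eta) - 1))))))%C by ring
      end.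
      rewrite HCi2. ring.
    + rewrite <- !cis_plus. f_equal. unfold phi, phase. ring.
Qed.
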